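(* Let $i\in\{-1,0,1\}$, $r\ge2$, $s\ge r+1$, and let $Y=Y^r_s$ be the blowup of $\mathbb{P}^r$ at $s$ general points. Let $D$ be an irreducible effective divisor on $Y$ whose class is a numerical $(i)$-divisorial class. Then $D$ is an $(i)$-Weyl hyperplane.
   Context: Work over $\mathbb{C}$. $A^1(Y)$ has basis $H$ (pullback of a hyperplane) and $E_1,\dots,E_s$ (exceptional divisors), $K_Y=-(r+1)H+(r-1)\sum E_i$, and $\langle dH-\sum m_iE_i,\,d'H-\sum m_i'E_i\rangle_1=(r-1)dd'-\sum m_im_i'$ (the Dolgachev–Mukai pairing). A numerical $(i)$-divisorial class is a class $[D]\in A^1(Y)$ with $\langle[D],[D]\rangle_1=i$ and $\frac{1}{r-1}\langle[D],-K_Y\rangle_1=2+i$. For an $(r+1)$-subset $I\subset\{1,\dots,s\}$ the Cremona action on $A^1(Y)$ is $\phi_I:dH-\sum m_jE_j\mapsto(d+t)H-\sum_{j\in I}(m_j+t)E_j-\sum_{j\notin I}m_jE_j$ with $t=(r-1)d-\sum_{j\in I}m_j$; the Weyl group $W$ is generated by all $\phi_I$ and the permutations of the indices. An $(i)$-Weyl hyperplane is a divisor in the Weyl orbit of (the proper transform of) a hyperplane through $r-1-i$ of the points, i.e. of class in the $W$-orbit of $H-E_1-\cdots-E_{r-1-i}$. *)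

(* Defs.v *)
From HB Require Import structures.
From mathcomp Require Import all_boot all_order all_algebra.
From mathcomp Require Import perm reals complex mpoly.

Set Implicit Arguments.
Unset Strict Implicit.
Unset Printing Implicit Defensive.

Import Order.TTheory GRing.Theory Num.Theory.
Local Open Scope ring_scope.

(** * The lattice A^1(Y), the Dolgachev-Mukai pairing and the Weyl group *)

(* The pair (d, m) stands for d H - \sum_j m_j E_j: note the sign. *)
Definition A1 (s : nat) := (int * 'rV[int]_s)%type.

Definition class_E s (j : 'I_s) : A1 s := (0, - delta_mx 0 j).

Definition class_K r s : A1 s := (- (r%:Z + 1), const_mx (- (r%:Z - 1))).

Definition dm_pairing r s (x y : A1 s) : int :=
  (r%:Z - 1) * x.1 * y.1 - \sum_j x.2 0 j * y.2 0 j.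

Definition numerical_class r s (i : int) (x : A1 s) : Prop :=
  dm_pairing r x x = i /\
  (r%:Z - 1)%:Q^-1 * (dm_pairing r x (- class_K r s))%:Q = (2 + i)%:Q.

Definition cremona r s (I : {set 'I_s}) (x : A1 s) : A1 s :=
  let t := (r%:Z - 1) * x.1 - \sum_(j in I) x.2 0 j in
  (x.1 + t, \row_j (if j \in I then x.2 0 j + t else x.2 0 j)).

Definition permute s (sigma : {perm 'I_s}) (x : A1 s) : A1 s :=
  (x.1, \row_j x.2 0 (sigma j)).

(* The generators are closed under inversion (see [cremonaK] below), so the
   monoid that they generate is the group that they generate. *)
Inductive weyl r s : (A1 s -> A1 s) -> Prop :=
| weyl_id : weyl r id
| weyl_cremona (I : {set 'I_s}) w :
    #|I| = r.+1 -> weyl r w -> weyl r (cremona r I \o w)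
| weyl_permute (sigma : {perm 'I_s}) w :
    weyl r w -> weyl r (permute sigma \o w).

Lemma cremonaK r s (I : {set 'I_s}) :
  #|I| = r.+1 -> involutive (cremona r I).
Proof.
move=> cI [d m]; rewrite /cremona /=.
set t := (r%:Z - 1) * d - _.
have -> : (r%:Z - 1) * (d + t) - \sum_(j in I)
    (\row_k (if k \in I then m 0 k + t else m 0 k)) 0 j = - t.
  rewrite (eq_bigr (fun j => m 0 j + t)); last by move=> j jI; rewrite mxE jI.
  rewrite big_split /= sumr_const cI -mulr_natl -natr1.
  rewrite mulrDr opprD addrACA -/t -mulrBl.
  rewrite natz opprD addrACA subrr add0r.
  by rewrite mulrDl mulN1r addrA subrr sub0r.
rewrite addrK; congr pair; apply/rowP=> j; rewrite !mxE.
by case: (j \in I); rewrite // addrK.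
Qed.

Lemma permuteK s (sigma : {perm 'I_s}) :
  cancel (permute sigma) (permute sigma^-1).
Proof.
by case=> d m; congr pair; apply/rowP=> j; rewrite !mxE permKV.
Qed.

(* H - E_1 - ... - E_{r-1-i} *)
Definition class_hyperplane r s (i : int) : A1 s :=
  (1, \row_j (if j%:Z < r%:Z - 1 - i then 1 else 0)).

Definition weyl_orbit_hyperplane r s (i : int) (x : A1 s) : Prop :=
  exists2 w, weyl r w & x = w (class_hyperplane r s i).

(** * The blowup of P^r at s points *)

Section Blowup.

Variables (R : realType) (r s : nat).
Let C := R[i].

(* The rows of P are homogeneous coordinates of s distinct points of P^r. *)
Definition distinct_points (P : 'M[C]_(s, r.+1)) : Prop :=
  (forall j, row j P != 0) /\
  (forall j k, j != k -> ~~ (row j P == row k P)%MS).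

Definition meval_mx p q (G : {mpoly C[p * q]}) (A : 'M[C]_(p, q)) : C :=
  G.@[fun k => mxvec A 0 k].

(* Homogeneous separately in the coordinates of each of the s points, so that
   [meval_mx G P = 0] defines a hypersurface in (P^r)^s. *)
Definition multihomogeneous (G : {mpoly C[s * r.+1]}) : Prop :=
  exists e : 'I_s -> nat, forall (c : 'rV[C]_s) (P : 'M[C]_(s, r.+1)),
    meval_mx G (diag_mx c *m P) = (\prod_j c 0 j ^+ e j) * meval_mx G P.

(* General points, in the sense of tuples of distinct points outside a countable
   union of hypersurfaces of (P^r)^s.  The exceptional set has to be countable:
   there are infinitely many divisor classes in general, and for (r, s) = (3, 9)
   the set of tuples carrying an irreducible divisor whose class is numerical
   of type i = -1 but outside the Weyl orbit is Zariski dense. *)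
Definition for_very_general_points (Q : 'M[C]_(s, r.+1) -> Prop) : Prop :=
  exists G : nat -> {mpoly C[s * r.+1]},
    (forall n, G n != 0 /\ multihomogeneous (G n)) /\
    (forall P, distinct_points P -> (forall n, meval_mx (G n) P != 0) -> Q P).

(* The blowup Y of P^r at the points P is the variety of tuples
   (x, L_1, ..., L_s), where x is a point of P^r and L_j is a line through both
   x and the j-th point.  A pair (x, y) of a vector and a matrix represents the
   tuple where L_j is spanned by the j-th rows of P and of y; two pairs
   represent the same point of Y when they are related by [same_point]. *)
Definition bl_coord := ('rV[C]_r.+1 * 'M[C]_(s, r.+1))%type.

Definition bl_line (P : 'M[C]_(s, r.+1)) (z : bl_coord) (j : 'I_s) :
  'M[C]_(1 + 1, r.+1) := col_mx (row j P) (row j z.2).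

Definition blowup (P : 'M[C]_(s, r.+1)) (z : bl_coord) : Prop :=
  z.1 != 0 /\
  forall j, row_free (bl_line P z j) /\ (z.1 <= bl_line P z j)%MS.

Definition same_point (P : 'M[C]_(s, r.+1)) (z z' : bl_coord) : Prop :=
  (z.1 == z'.1)%MS /\ forall j, (bl_line P z j == bl_line P z' j)%MS.

(* Subsets of Y are [same_point]-invariant subsets of the set of representing
   pairs, which is a quasi-affine variety; Y carries the quotient topology. *)
Definition zariski_closed (P : 'M[C]_(s, r.+1)) (Z : bl_coord -> Prop) : Prop :=
  [/\ forall z, Z z -> blowup P z,
      forall z z', blowup P z' -> same_point P z z' -> Z z -> Z z'
    & exists S : {mpoly C[(1 + s) * r.+1]} -> Prop,
        forall z, blowup P z ->
          (Z z <-> forall G, S G -> meval_mx G (col_mx z.1 z.2) = 0)].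

Definition zsub (Z Z' : bl_coord -> Prop) : Prop := forall z, Z z -> Z' z.

Definition irreducible_closed (P : 'M[C]_(s, r.+1)) (Z : bl_coord -> Prop) :
    Prop :=
  [/\ zariski_closed P Z, exists z, Z z
    & forall Z1 Z2, zariski_closed P Z1 -> zariski_closed P Z2 ->
        (forall z, Z z -> Z1 z \/ Z2 z) -> zsub Z Z1 \/ zsub Z Z2].

(* Irreducible closed subsets of codimension 1: as Y is irreducible, these are
   the maximal ones among those distinct from Y. *)
Definition prime_divisor (P : 'M[C]_(s, r.+1)) (D : bl_coord -> Prop) : Prop :=
  [/\ irreducible_closed P D, ~ zsub (blowup P) D
    & forall Z, irreducible_closed P Z -> zsub D Z ->
        zsub Z D \/ zsub (blowup P) Z].

Definition exceptional (P : 'M[C]_(s, r.+1)) (j : 'I_s) (z : bl_coord) : Prop :=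
  blowup P z /\ (z.1 == row j P)%MS.

(* The order of vanishing of F at p; for a homogeneous F and p != 0 this is the
   multiplicity of the hypersurface F = 0 of P^r at the point p. *)
Definition has_multiplicity (F : {mpoly C[r.+1]}) (p : 'rV[C]_r.+1) (m : nat) :
    Prop :=
  (forall a : 'X_{1..r.+1}, (mdeg a < m)%N ->
     (mderivm a F).@[fun k => p 0 k] = 0) /\
  (exists2 a : 'X_{1..r.+1}, mdeg a = m &
     (mderivm a F).@[fun k => p 0 k] != 0).

(* F generates the homogeneous ideal of the image of D in P^r. *)
Definition image_equation (D : bl_coord -> Prop) (F : {mpoly C[r.+1]}) : Prop :=
  forall G : {mpoly C[r.+1]},
    (forall z, D z -> G.@[fun k => z.1 0 k] = 0) <-> exists Q, G = Q * F.

(* The class of a prime divisor D.  If D is not exceptional, it is the proper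
   transform of its image in P^r, which is a hypersurface; when that image has
   degree d and multiplicities m_j at the points, D has class
   d H - \sum_j m_j E_j. *)
Inductive divisor_class (P : 'M[C]_(s, r.+1)) (D : bl_coord -> Prop) :
    A1 s -> Prop :=
| Class_exceptional j :
    (forall z, D z <-> exceptional P j z) -> divisor_class P D (class_E j)
| Class_proper_transform (d : nat) (m : 'I_s -> nat) (F : {mpoly C[r.+1]}) :
    F \is d.-homog -> image_equation D F ->
    (forall j, has_multiplicity F (row j P) (m j)) ->
    divisor_class P D (d%:Z, \row_j (m j)%:Z).

Definition weyl_hyperplane (P : 'M[C]_(s, r.+1)) (i : int)
    (D : bl_coord -> Prop) : Prop :=
  prime_divisor P D /\
  exists2 x, divisor_class P D x & weyl_orbit_hyperplane r i x.

End Blowup.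

(* Main.v *)
Require Import Defs.
From HB Require Import structures.
From mathcomp Require Import all_boot all_order all_algebra.
From mathcomp Require Import boolp ring zify perm reals complex mpoly.
Set Implicit Arguments.
Unset Strict Implicit.
Unset Printing Implicit Defensive.
Import Order.TTheory GRing.Theory Num.Theory.
Local Open Scope ring_scope.

(* A very general configuration of points carries no irreducible form whose class
   is numerical of type i outside the Weyl orbit; this is shown class by class, by
   induction on the degree.  Let I index the r + 1 largest multiplicities of the
   class (d, m).  If their sum is at most (r - 1) d, then Noether's inequality
   forces d <= 1, and such classes lie in the orbit.  Otherwise the Cremona map
   based at the points of I lowers the degree: in coordinates where these points
   are the coordinate points it replaces F by the reciprocal form
   y^delta F(1 / y), where delta is the vector of the degrees of F in each
   variable.  The reciprocal form is irreducible, its class is the image of (d, m)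
   under the Cremona action, and its multiplicity at a point off the coordinate
   hyperplanes is that of F at the image point.  The map on configurations of
   points is a birational involution up to rescaling, so general configurations
   go to general configurations. *)

(** * Polynomials in several variables and weights *)

Lemma mpoly_alg_ind n (K : comNzRingType) (P : {mpoly K[n]} -> Prop) :
  (forall c, P c%:MP) -> (forall i, P 'X_i) ->
  (forall p q, P p -> P q -> P (p + q)) ->
  (forall p q, P p -> P q -> P (p * q)) -> forall p, P p.
Proof.
move=> PC PX PD PM p; rewrite [p]mpolyE.
apply: (big_ind P) => [||m _]; [by rewrite -mpolyC0|exact: PD|].
rewrite -mul_mpolyC; apply: (PM _ _ (PC _)); rewrite mpolyXE_id.
apply: (big_ind P) => [||i _]; [by rewrite -mpolyC1|exact: PM|].
elim: (m i) => [|k IH]; first by rewrite expr0 -mpolyC1.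
by rewrite exprS; apply: PM.
Qed.

Lemma mmap_eqf n (K S : nzRingType) (f : K -> S) (h h' : 'I_n -> S) p :
  h =1 h' -> mmap f h p = mmap f h' p.
Proof. by move=> eh; apply: eq_bigr => m _; rewrite (mmap1_eq _ eh). Qed.

Lemma mmap_var n (K : comNzRingType) (S : comNzRingType) (f : {rmorphism K ->
  S})
    (h : 'I_n -> S) i : mmap f h 'X_i = h i.
Proof. by rewrite mmapX mmap1U. Qed.

Lemma mmap_comp n k (K S : comNzRingType) (f : {rmorphism K -> S})
    (h : 'I_k -> S) (g : 'I_n -> {mpoly K[k]}) p :
  mmap f h (mmap (@mpolyC k K) g p) = mmap f (fun i => mmap f h (g i)) p.
Proof.
elim/mpoly_alg_ind: p => [c|i|p q Hp Hq|p q Hp Hq].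
- by rewrite !mmapC.
- by rewrite !mmap_var.
- by rewrite !rmorphD /= Hp Hq.
- by rewrite !rmorphM /= Hp Hq.
Qed.

Lemma mmap_idX n (K : comNzRingType) (p : {mpoly K[n]}) :
  mmap (@mpolyC n K) (fun i => 'X_i) p = p.
Proof.
elim/mpoly_alg_ind: p => [c|i|p q Hp Hq|p q Hp Hq].
- by rewrite mmapC.
- by rewrite mmap_var.
- by rewrite rmorphD /= Hp Hq.
- by rewrite rmorphM /= Hp Hq.
Qed.

Lemma rmorph_mmap n (K S T : comNzRingType) (f : {rmorphism K -> S})
    (g : {rmorphism S -> T}) (h : 'I_n -> S) p :
  g (mmap f h p) = mmap (g \o f) (g \o h) p.
Proof.
elim/mpoly_alg_ind: p => [c|i|p q Hp Hq|p q Hp Hq].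
- by rewrite !mmapC.
- by rewrite !mmap_var.
- by rewrite !rmorphD /= Hp Hq.
- by rewrite !rmorphM /= Hp Hq.
Qed.

Definition weight n (w : 'I_n -> nat) (a : 'X_{1..n}) : nat := \sum_i w i * a i.

Definition weight_part n (K : nzRingType) (w : 'I_n -> nat) (k : nat)
    (F : {mpoly K[n]}) : {mpoly K[n]} :=
  \sum_(a <- msupp F | weight w a == k) F@_a *: 'X_[a].

Section WeightedComponents.

Variables (n : nat) (K : comNzRingType).
Implicit Types (w : 'I_n -> nat) (F : {mpoly K[n]}).

Lemma mcoeff_weight_part w k F a : (weight_part w k F)@_a = F@_a *+ (weight w
  a == k).
Proof.
rewrite /weight_part raddf_sum /= big_mkcond /=.
have [aF|aF] := boolP (a \in msupp F).
  rewrite (bigD1_seq a) ?msupp_uniq //= mcoeffZ mcoeffX eqxx mulr1.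
  rewrite big1 ?addr0 => [|b ba]; first by case: eqP.
  by case: ifP => // _; rewrite mcoeffZ mcoeffX (negbTE ba) mulr0.
rewrite (memN_msupp_eq0 aF) mul0rn big1_seq // => b /= bF.
case: ifP => // _; rewrite mcoeffZ mcoeffX; case: eqP => [ba|_]; last first.
  by rewrite mulr0.
by rewrite -ba bF in aF.
Qed.

(** Substituting v_i T^(w_i) for X_i multiplies a monomial by T to its weight, so the coefficients
    in T separate the weights. Single weighted components are always reached through such
    one-parameter curves. *)
Lemma coef_mmap_weight (S : comNzRingType) (f : {rmorphism K -> S})
    (v : 'I_n -> S) w F k :
  (mmap (polyC \o f) (fun i => v i *: 'X^(w i)) F)`_k = mmap f v (weight_part
    w k F).
Proof.
have H a : mmap1 (fun i => v i *: 'X^(w i)) a = mmap1 v a *: 'X^(weight w a).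
  rewrite /mmap1 /weight; elim/big_rec3: _ => [|i y1 y2 y3 _ ->].
    by rewrite expr0 scale1r.
  by rewrite exprZn -scalerAl -scalerAr scalerA -exprM -exprD.
rewrite /weight_part raddf_sum /= {1}/mmap coef_sum big_mkcond [RHS]big_mkcond
  /=.
apply: eq_bigr => a _; rewrite H coefCM coefZ coefXn eq_sym.
by case: eqP => _; rewrite ?mulr1 ?mulr0 // mmapZ mmapX.
Qed.

End WeightedComponents.

(** * Nonzero polynomials and points where they do not vanish *)

Section Infinite.

Variable K : numFieldType.

Lemma poly_horner_eq0 (p : {poly K}) : (forall c, p.[c] = 0) -> p = 0.
Proof.
move=> H; apply/eqP; case: eqVneq => // p0.
(* In characteristic zero the numbers 0, ..., [size p] - 1 are pairwise distinct, whereas a nonzero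
   [p] has fewer than [size p] roots. *)
have := @max_poly_roots K p [seq i%:R | i <- iota 0 (size p)] p0.
rewrite size_map size_iota ltnn => -> //.
  by apply/allP => x _; apply/eqP/H.
rewrite map_inj_uniq ?iota_uniq // => x y /eqP.
by rewrite eqr_nat => /eqP.
Qed.

Lemma meval_weight_part_eq0 n (w : 'I_n -> nat) k (F : {mpoly K[n]}) :
  (forall v, F.@[v] = 0) -> forall v, (weight_part w k F).@[v] = 0.
Proof.
move=> H v; rewrite /meval -(@coef_mmap_weight n K K idfun) /=.
rewrite (_ : mmap _ _ _ = 0) ?coef0 //; apply: poly_horner_eq0 => c.
rewrite -horner_evalE rmorph_mmap /= -[RHS](H (fun i => v i * c ^+ w i)).
rewrite /meval /mmap; apply: eq_bigr => a _; congr (_ * _).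
  by rewrite /= horner_evalE hornerC.
by apply: mmap1_eq => i /=; rewrite horner_evalE hornerZ hornerXn.
Qed.

(** Taking in turn, for each variable l, the part of degree [a l] in that variable keeps all values
    zero and leaves only the monomial a, whose coefficient is its value at (1, ..., 1). *)
Lemma mpoly_meval_eq0 n (F : {mpoly K[n]}) : (forall v, F.@[v] = 0) -> F = 0.
Proof.
move=> H; apply/mpolyP => a; rewrite mcoeff0.
pose c (l : 'I_n) : {mpoly K[n]} -> {mpoly K[n]} :=
  weight_part (fun i => nat_of_bool (i == l)) (a l).
have wd (l : 'I_n) b : weight (fun i => nat_of_bool (i == l)) b = b l.
  by rewrite /weight (bigD1 l) //= eqxx mul1n big1 ?addn0 // => i /negbTE ->.
pose G := foldr c F (enum 'I_n).
have G0 v : G.@[v] = 0.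
  rewrite /G; elim: (enum _) v => [|l s IH] v /=; first exact: H.
  by apply: meval_weight_part_eq0.
have GE s b : (foldr c F s)@_b = F@_b *+ all (fun l => b l == a l) s.
  elim: s => [|l s IH] //=; rewrite mcoeff_weight_part IH wd.
  by case: (b l == a l).
have -> : F@_a = G.@[fun=> 1]; last exact: G0.
have -> : G = F@_a *: 'X_[a].
  apply/mpolyP => b; rewrite GE mcoeffZ mcoeffX.
  case: eqP => [<-|ab]; first by rewrite mulr1 (_ : all _ _) //; apply/allP.
  rewrite mulr0 (_ : all _ _ = false) //; apply/negbTE/allPn.
  have /existsP[l lP] : [exists l, b l != a l].
    rewrite -negb_forall; apply/negP => /forallP E; apply: ab.
    by apply/mnmP => i; rewrite (eqP (E i)).
  by exists l; rewrite ?mem_enum.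
rewrite mevalZ mevalX big1 ?mulr1 // => i _; exact: expr1n.
Qed.

Lemma mpoly_meval_neq0 n (F : {mpoly K[n]}) : F != 0 ->
  exists v, (forall i, v i != 0) /\ F.@[v] != 0.
Proof.
(* The extra factor forces every coordinate of a point of nonvanishing to be nonzero. *)
move=> F0; pose G := F * \prod_i 'X_i.
have /eqP G0 : G != 0.
  rewrite mulf_neq0 //; apply/prodf_neq0 => i _.
  by rewrite -msupp_eq0 msuppX.
have [v Gv] : exists v, G.@[v] != 0.
  apply/not_existsP => H; apply: G0; apply: mpoly_meval_eq0 => v.
  by apply/eqP; case: eqVneq (H v).
move: Gv; rewrite /G mevalM rmorph_prod mulf_eq0 negb_or => /andP[Fv
  /prodf_neq0 vP].
by exists v; split => // i; have := vP i isT; rewrite /= mevalXU.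
Qed.

End Infinite.

(** * Order of vanishing *)

Lemma dvdXnP (K : fieldType) m (q : {poly K}) :
  reflect (forall k, (k < m)%N -> q`_k = 0) ('X^m %| q)%R.
Proof.
apply: (iffP idP) => [/dvdpP[u ->] k km|H]; first by rewrite coefMXn km.
rewrite -[q](poly_take_drop m) (_ : take_poly m q = 0) ?add0r ?dvdp_mull //.
by apply/polyP => k; rewrite coef_take_poly coef0; case: ltnP => // /H.
Qed.

Lemma dvdXn_unit (K : fieldType) m (u q : {poly K}) :
  u.[0] != 0 -> ('X^m %| u * q)%R = ('X^m %| q)%R.
Proof.
move=> u0; rewrite Gauss_dvdpr // coprimep_expl //.
by rewrite coprimep_sym -['X]subr0 -polyC0 coprimep_XsubC rootE.
Qed.

Lemma mmap_dhomog_scale n (K S : comNzRingType) (f : {rmorphism K -> S}) d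
    (F : {mpoly K[n]}) (c : S) (h : 'I_n -> S) :
  F \is d.-homog -> mmap f (fun i => c * h i) F = c ^+ d * mmap f h F.
Proof.
move=> /dhomogP hF; rewrite /mmap mulr_sumr big_seq [RHS]big_seq.
apply: eq_bigr => a aF; rewrite mulrCA; congr (_ * _).
have -> : d = (\sum_i a i)%N by rewrite -mdegE -(hF a aF).
rewrite /mmap1 -prodrXr -big_split /=.
by apply: eq_bigr => i _; rewrite exprMn.
Qed.

Lemma meval_coef0 n (K : comNzRingType) (F : {mpoly K[n]}) :
  F.@[fun=> 0] = F@_0%MM.
Proof.
elim/mpoly_alg_ind: F => [c|i|p q Hp Hq|p q Hp Hq].
- by rewrite mevalC mcoeffC eqxx mulr1.
- by rewrite mevalXU mcoeffX mnm1_eq0.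
- by rewrite mevalD mcoeffD Hp Hq.
- by rewrite mevalM rmorphM /= Hp Hq.
Qed.

Section OrderOfVanishing.

Variables (K : numFieldType) (n : nat).
Implicit Types (F G : {mpoly K[n]}) (p : 'rV[K]_n) (g : 'rV[{poly K}]_n).

Definition arc_eval F g : {poly K} := mmap (@polyC K) (fun k => g 0 k) F.

(* Vanishing to order m is tested on all polynomial arcs through p, which
   behaves well under polynomial changes of coordinates. *)
Definition vanish_ge F p m : Prop :=
  forall g, (forall k, (g 0 k).[0] = p 0 k) -> ('X^m %| arc_eval F g)%R.

Definition mult F p m : Prop := vanish_ge F p m /\ ~ vanish_ge F p m.+1.

Lemma mult_congr F G p q m :
  (forall k, vanish_ge F p k <-> vanish_ge G q k) -> mult F p m -> mult G q m.
Proof. by move=> H [H1 H2]; split; [apply/H|move/H]. Qed.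

(** If a weight k < m occurs in F, the part of weight k is nonzero at some v with nonzero
    coordinates, and its value there is the coefficient of T^k along the curve v_i T^(w_i). Nonzero
    coordinates matter in [vanish_ge_delta], where the curve must start at a nonzero multiple of a
    coordinate point. *)
Lemma weight_ge F (w : 'I_n -> nat) m :
  (forall v : 'I_n -> K, (forall i, v i != 0) ->
     'X^m %| mmap (@polyC K) (fun i => v i *: 'X^(w i)) F)%R ->
  forall a, a \in msupp F -> (m <= weight w a)%N.
Proof.
move=> H a aF; rewrite leqNgt; apply/negP => am.
have [|v [v0 Fv]] := @mpoly_meval_neq0 K n (weight_part w (weight w a) F).
  apply: contraNneq (_ : F@_a != 0) => [E|]; last by rewrite -mcoeff_msupp.
  by have := mcoeff_weight_part w (weight w a) F a;
    rewrite E mcoeff0 eqxx mulr1n => <-.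
move/dvdXnP/(_ _ am): (H v v0) => /eqP.
by rewrite (@coef_mmap_weight n K K idfun) (negPf Fv).
Qed.

Lemma dvdXn_arc_eval F (w : 'I_n -> nat) m g :
  (forall k, 'X^(w k) %| g 0 k)%R ->
  (forall a, a \in msupp F -> (m <= weight w a)%N) -> ('X^m %| arc_eval F g)%R.
Proof.
move=> gw Fw; rewrite /arc_eval /mmap big_seq.
apply: (big_ind (fun q => 'X^m %| q)%R) => [||a aF]; first exact: dvdp0.
  by move=> x y; apply: dvdp_add.
apply/dvdp_mull/(dvdp_trans (dvdp_exp2l _ (Fw a aF))).
rewrite /weight /mmap1; elim/big_rec2: _ => [|i k q _ kq];
  first by rewrite expr0 dvdpp.
by rewrite exprD dvdp_mul // exprM dvdp_exp2r.
Qed.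

Lemma vanish_ge0P F m :
  vanish_ge F 0 m <-> forall a, a \in msupp F -> (m <= mdeg a)%N.
Proof.
have wd (a : 'X_{1..n}) : mdeg a = weight (fun=> 1%N) a.
  by rewrite mdegE; apply: eq_bigr => i _; rewrite mul1n.
split=> [H a aF|H g g0].
  rewrite wd; apply: weight_ge aF => v _.
  have := H (\row_k (v k *: 'X^1)); rewrite /arc_eval;
    under mmap_eqf do rewrite mxE.
  by apply=> k; rewrite !mxE hornerZ hornerXn expr1 mulr0.
apply: (@dvdXn_arc_eval _ (fun=> 1%N)) => [k|a aF]; last by rewrite -wd H.
by rewrite expr1 -['X]subr0 -polyC0 dvdp_XsubCl rootE g0 mxE.
Qed.

Lemma vanish_ge_scale F d p c m :
  F \is d.-homog -> c != 0 -> vanish_ge F (c *: p) m <-> vanish_ge F p m.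
Proof.
move=> hF; have H (c' : K) q : c' != 0 -> vanish_ge F q m -> vanish_ge F (c'
  *: q) m.
  move=> c0 Hq g gE.
  have := Hq (\row_k (c'^-1%:P * g 0 k)); rewrite /arc_eval.
  under mmap_eqf do rewrite mxE.
  rewrite (mmap_dhomog_scale _ _ _ hF) dvdXn_unit.
    by apply=> k; rewrite mxE hornerM hornerC gE mxE mulKf.
  by rewrite -rmorphXn hornerC expf_neq0 // invr_eq0.
move=> c0; split=> [/(H c^-1)|]; last exact: H.
by rewrite scalerA mulVf // scale1r; apply; rewrite invr_eq0.
Qed.

Lemma vanish_ge_delta F d l m : F \is d.-homog ->
  vanish_ge F (delta_mx 0 l) m <-> forall a, a \in msupp F -> (a l + m <= d)%N.
Proof.
(* [w] ignores the variable l, so a monomial a of the form has weight d - a l; the curve v_k T^(w k)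
   starts at v_l times the coordinate point, which differs from it by a rescaling only. *)
move=> hF; pose w k : nat := k != l.
have wd a : a \in msupp F -> (a l + weight w a = d)%N.
  move=> aF; rewrite -(dhomog_mf hF aF) /= mdegE (bigD1 l) //=; congr addn.
  rewrite /weight (bigD1 l) //= /w eqxx mul0n add0n.
  by apply: eq_bigr => i ->; rewrite mul1n.
split=> [H a aF|H g g0].
  rewrite -(wd a aF) leq_add2l; apply: weight_ge aF => v v0.
  have /(vanish_ge_scale _ _ hF (v0 l)) H' := H.
  have := H' (\row_k (v k *: 'X^(w k))); rewrite /arc_eval.
  under mmap_eqf do rewrite mxE.
  apply=> k; rewrite !mxE hornerZ hornerXn /w eqxx /=.
  by case: (eqVneq k l) => [->|_]; rewrite ?expr0 // expr1 !mulr0.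
apply: (@dvdXn_arc_eval _ w) => [k|a aF]; last first.
  by rewrite -(leq_add2l (a l)) wd // H.
rewrite /w; case: eqVneq => kl /=; first by rewrite expr0 dvd1p.
rewrite expr1 -['X]subr0 -polyC0 dvdp_XsubCl rootE g0 mxE eqxx /=.
by rewrite (negbTE kl).
Qed.

Definition translate p F := mmap (@mpolyC n K) (fun k => 'X_k + (p 0 k)%:MP) F.

Lemma translate_mderiv p F i : translate p F^`M(i) = (translate p F)^`M(i).
Proof.
have tD q q' : translate p (q + q') = translate p q + translate p q' by
  rewrite /translate rmorphD.
have tM q q' : translate p (q * q') = translate p q * translate p q' by
  rewrite /translate rmorphM.
elim/mpoly_alg_ind: F => [c|j|q q' Hq Hq'|q q' Hq Hq'].
- by rewrite /translate mmapC !mderivC mmap0.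
- rewrite /translate mmap_var mderivD mderivC addr0 !mderivX.
  rewrite mmapZ mnm1E; case: eqP => [->|_];
    last by rewrite !mulr0n rmorph0 scale0r mul0r.
  have -> : (U_(i) - U_(i) = 0)%MM by apply/mnmP => k;
    rewrite mnmBE subnn mnm0E.
  by rewrite mpolyX0 mulr1n scale1r !rmorph1 mulr1.
- by rewrite mderivD !tD mderivD Hq Hq'.
- by rewrite mderivM tD !tM mderivM Hq Hq'.
Qed.

Lemma translate_mderivm p F a : translate p F^`M[a] = (translate p F)^`M[a].
Proof.
rewrite !mderivm_foldr; elim: (flatten _) => [//|i s IH] /=.
by rewrite translate_mderiv IH.
Qed.

Lemma meval_trans p F : F.@[fun k => p 0 k] = (translate p F)@_0%MM.
Proof.
rewrite -meval_coef0 /meval /translate (mmap_comp idfun); apply: mmap_eqf => k.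
by rewrite rmorphD /= mmapC mmap_var add0r.
Qed.

Lemma vanish_ge_trans p F m : vanish_ge F p m <-> vanish_ge (translate p F) 0 m.
Proof.
have E g : arc_eval (translate p F) g = arc_eval F (g + map_mx polyC p).
  rewrite /arc_eval /translate mmap_comp; apply: mmap_eqf => k.
  by rewrite rmorphD /= mmapC mmap_var !mxE.
split=> H g g0.
  by rewrite E; apply: H => k; rewrite !mxE hornerD hornerC g0 mxE add0r.
rewrite -[g](subrK (map_mx polyC p)) -E; apply: H => k.
by rewrite !mxE hornerD hornerN hornerC g0 subrr.
Qed.

Lemma meval_mderivm p F (a : 'X_{1..n}) :
  F^`M[a].@[fun k => p 0 k] = (translate p F)@_a *+ \prod_i (a i)`!.
Proof.
rewrite meval_trans translate_mderivm mcoeff_mderivm addm0; congr (_ *+ _).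
by apply: eq_bigr => i _; rewrite ffactnn.
Qed.

(** Bridge from arcs to the derivatives of [has_multiplicity]: after translating p to the origin,
    the derivative of index a at p is a! times the coefficient of a, and a! is nonzero in
    characteristic zero. *)
Lemma vanish_ge_mderivm F p m : vanish_ge F p m <->
  forall a, (mdeg a < m)%N -> F^`M[a].@[fun k => p 0 k] = 0.
Proof.
rewrite vanish_ge_trans vanish_ge0P; split=> [H a am|H a aF].
  rewrite meval_mderivm memN_msupp_eq0 ?mul0rn //.
  by apply/negP => /H; rewrite leqNgt am.
rewrite leqNgt; apply/negP => /H /eqP; rewrite meval_mderivm.
rewrite -mulr_natr mulf_eq0 (mcoeff_eq0 _ a) aF /= pnatr_eq0.
apply/negP; rewrite -lt0n; apply/prodn_gt0 => i; exact: fact_gt0.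
Qed.

End OrderOfVanishing.

(** * The reciprocal of a form *)

Lemma bigmax_seq_attained (T : eqType) (f : T -> nat) (s : seq T) :
  s != [::] -> exists2 a, a \in s & f a = \max_(x <- s) f x.
Proof.
elim: s => // x s IH _; rewrite big_cons.
have [->|/IH[a aS aE]] := eqVneq s [::].
  by exists x; rewrite ?mem_seq1 // big_nil maxn0.
have [le|le] := leqP (\max_(y <- s) f y) (f x).
  by exists x; rewrite ?mem_head.
by exists a; first by rewrite inE aS orbT.
Qed.

(** Only factorizations into forms are tested, and nonzero constants pass; degree bounds are imposed
    separately. *)
Definition irr_form n (K : nzRingType) (F : {mpoly K[n]}) : Prop :=
  forall d e A B, A \is d.-homog -> B \is e.-homog -> F = A * B ->
    d = 0%N \/ e = 0%N.

Section Cremona.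

Variables (n : nat).

(* Homogeneous coordinates of (1/y_1 : ... : 1/y_n), without division. *)
Definition inv_coord (S : comNzRingType) (h : 'I_n -> S) (l : 'I_n) : S :=
  \prod_(k | k != l) h k.

Lemma mul_inv_coord (S : comNzRingType) (h : 'I_n -> S) l :
  h l * inv_coord h l = \prod_k h k.
Proof. by rewrite [RHS](bigD1 l). Qed.

Lemma inv_coord_scale (S : comNzRingType) (h : 'I_n -> S) c l :
  inv_coord (fun k => c * h k) l = c ^+ n.-1 * inv_coord h l.
Proof.
rewrite /inv_coord big_split /= prodr_const; congr (_ ^+ _ * _).
by rewrite (cardC1 l) card_ord.
Qed.

(** Exchange the double product: a factor h_j with j != l occurs for the indices k other than j and
    l, hence n - 2 times, while h_l occurs n - 1 times. *)
Lemma inv_coordK (S : comNzRingType) (h : 'I_n -> S) l :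
  (1 < n)%N -> inv_coord (inv_coord h) l = (\prod_k h k) ^+ n.-2 * h l.
Proof.
move=> n1; rewrite {1}/inv_coord /inv_coord.
under eq_bigr do rewrite big_mkcond /=.
rewrite exchange_big /= -prodrXl [LHS](bigD1 l) //= [in RHS](bigD1 l) //=.
rewrite mulrAC -exprSr; congr (_ * _).
  rewrite (eq_bigr (fun=> h l)) => [|k kl]; last by rewrite eq_sym kl.
  by rewrite prodr_const (cardC1 l) card_ord [n.-2.+1]prednK // -subn1 subn_gt0.
apply: eq_bigr => j jl; rewrite -big_mkcondr /=.
rewrite prodr_const; congr (_ ^+ _).
have -> : #|[pred k | (k != l) && (j != k)]| = #|[set~ l] :\ j|.
  by rewrite -cardsE; apply: eq_card => k; rewrite !inE andbC eq_sym.
have := cardsD1 j [set~ l]; rewrite cardsC1 card_ord !inE jl.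
by move/(congr1 predn) => ->.
Qed.

Variable K : idomainType.
Implicit Types (F A B : {mpoly K[n]}).

Definition max_exp F : 'X_{1..n} := [multinom (\max_(a <- msupp F) a i) | i <
  n].

Definition recip F : {mpoly K[n]} :=
  \sum_(a <- msupp F) F@_a *: 'X_[max_exp F - a].

(** No variable divides F. On such polynomials [recip] is an involution. *)
Definition Xfree F : Prop := forall l, exists2 a, a \in msupp F & a l = 0%N.

Lemma msupp_le_max_exp F a : a \in msupp F -> (a <= max_exp F)%MM.
Proof.
move=> aF; apply/mnm_lepP => i; rewrite mnmE.
by rewrite (big_rem a) //= leq_maxl.
Qed.

Lemma max_exp_attained F l : F != 0 -> exists2 a, a \in msupp F & a l =
  max_exp F l.
Proof.
rewrite -msupp_eq0 => /(bigmax_seq_attained (fun a : 'X_{1..n} => a l))[a aF E].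
by exists a => //; rewrite mnmE.
Qed.

Lemma subKm (a b : 'X_{1..n}) : (a <= b)%MM -> (b - (b - a) = a)%MM.
Proof. by move/mnm_lepP=> H; apply/mnmP => i; rewrite !mnmBE subKn. Qed.

Lemma mcoeff_recip F b :
  (recip F)@_b = F@_(max_exp F - b) *+ (b <= max_exp F)%MM.
Proof.
rewrite /recip raddf_sum /=; have [bd|bd] := boolP (_ <= _)%MM; last first.
  rewrite big1_seq // => a /= aF; rewrite mcoeffZ mcoeffX.
  case: eqP => [E|_]; last by rewrite mulr0.
  case/negP: bd; rewrite -E; apply/mnm_lepP => i.
  by rewrite mnmBE leq_subr.
have H a : a \in msupp F -> (max_exp F - a == b)%MM = (a == max_exp F - b)%MM.
  by move=> /msupp_le_max_exp aF; apply/eqP/eqP => [<-|->]; rewrite subKm.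
rewrite (eq_big_seq (fun a => F@_a * (a == max_exp F - b)%MM%:R)); last first.
  by move=> a aF; rewrite mcoeffZ mcoeffX H.
have [bF|bF] := boolP ((max_exp F - b)%MM \in msupp F).
  rewrite (bigD1_seq _ bF) ?msupp_uniq //= eqxx mulr1 big1 ?addr0 // => a.
  by move/negbTE->; rewrite mulr0.
rewrite memN_msupp_eq0 // big1_seq // => a /= aF.
by case: eqP => [E|_]; [case/negP: bF; rewrite -E|rewrite mulr0].
Qed.

Lemma msupp_recip F b :
  (b \in msupp (recip F)) = (b <= max_exp F)%MM && ((max_exp F - b)%MM \in
    msupp F).
Proof.
rewrite !mcoeff_msupp mcoeff_recip.
by case: (_ <= _)%MM; rewrite ?mulr1n // mulr0n eqxx.
Qed.

Lemma msupp_recip_sub F a :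
  a \in msupp F -> (max_exp F - a)%MM \in msupp (recip F).
Proof.
move=> aF; rewrite msupp_recip (subKm (msupp_le_max_exp aF)) aF andbT.
by apply/mnm_lepP => i; rewrite mnmBE leq_subr.
Qed.

Lemma recip_neq0 F : F != 0 -> recip F != 0.
Proof.
move=> F0; have [a aF] : exists a, a \in msupp F.
  by exists (mlead F); apply: mlead_supp.
apply: contraTneq (msupp_recip_sub aF) => ->.
by rewrite msupp0.
Qed.

(** The exponents of l in the reciprocal are [max_exp F l] - a l, and the bound is reached at a
    monomial a free of l, which [Xfree] provides. *)
Lemma max_exp_recip F : Xfree F -> max_exp (recip F) = max_exp F.
Proof.
move=> XF; apply/mnmP => l; apply/eqP; rewrite eqn_leq.
apply/andP; split.
  rewrite {1}/max_exp mnmE; apply/bigmax_leqP_seq => b;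
    rewrite msupp_recip => /andP[/mnm_lepP H _] _.
  exact: H.
have [a aF a0] := XF l.
have /mnm_lepP/(_ l) := msupp_le_max_exp (msupp_recip_sub aF).
by rewrite mnmBE a0 subn0.
Qed.

Lemma Xfree_recip F : F != 0 -> Xfree (recip F).
Proof.
move=> F0 l; have [a aF E] := max_exp_attained l F0.
by exists (max_exp F - a)%MM; rewrite ?msupp_recip_sub // mnmBE E subnn.
Qed.

Lemma recipK F : Xfree F -> recip (recip F) = F.
Proof.
move=> XF; apply/mpolyP => b; rewrite !mcoeff_recip max_exp_recip //.
have [bd|bd] := boolP (b <= max_exp F)%MM.
  rewrite subKm // mulr1n (_ : (_ <= _)%MM) //.
  by apply/mnm_lepP => i; rewrite mnmBE leq_subr.
by rewrite mulr0n memN_msupp_eq0 //; apply: contraNN bd;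
  apply: msupp_le_max_exp.
Qed.

Lemma mdeg_subm (a b : 'X_{1..n}) : (a <= b)%MM -> mdeg (b - a) = (mdeg b -
  mdeg a)%N.
Proof. by move=> ab; rewrite -{2}(submK ab) mdegD addnK. Qed.

Lemma dhomog_recip F d :
  F \is d.-homog -> recip F \is (mdeg (max_exp F) - d).-homog.
Proof.
move=> hF; apply: rpred_sum => a _; have [aF|aF] := boolP (a \in msupp F).
  rewrite rpredZ // dhomogX /= mdeg_subm ?msupp_le_max_exp //.
  by rewrite -(dhomog_mf hF aF).
by rewrite memN_msupp_eq0 // scale0r rpred0.
Qed.

(** This is the identity recip F (h) = h^delta F(1/h) with denominators cleared: (\prod h)^d F(1/h)
    is F at [inv_coord h]. *)
Lemma mmap_recip (S : comNzRingType) (f : {rmorphism K -> S}) (h : 'I_n -> S)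
  F d :
  F \is d.-homog ->
  mmap f h (recip F) * (\prod_k h k) ^+ d =
  mmap1 h (max_exp F) * mmap f (inv_coord h) F.
Proof.
move=> hF; rewrite /recip raddf_sum /= mulr_suml [in RHS]/mmap mulr_sumr.
apply: eq_big_seq => a aF; rewrite mmapZ mmapX mulrCA -mulrA; congr (_ * _).
have -> : d = (\sum_i a i)%N by rewrite -mdegE -(dhomog_mf hF aF).
rewrite -{2}(submK (msupp_le_max_exp aF)) commr_mmap1_M; last first.
  by move=> i x; apply: mulrC.
rewrite -mulrA; congr (_ * _); rewrite -prodrXr -big_split /=.
by apply: eq_bigr => i _; rewrite -exprMn mul_inv_coord.
Qed.

(** Replaces X_l by X_l T for a new variable T. This is a ring morphism into univariate polynomials
    over a domain; the size in T reads off the degree in X_l, and the constant coefficient collects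
    the monomials free of X_l. *)
Definition expand_var l F : {poly {mpoly K[n]}} :=
  mmap (polyC \o @mpolyC n K) (fun i => 'X_i *: 'X^(i == l)) F.

Lemma coef_expand_var l F j b : ((expand_var l F)`_j)@_b = F@_b *+ (b l == j).
Proof.
rewrite coef_mmap_weight mmap_idX mcoeff_weight_part.
rewrite /weight (bigD1 l) //= eqxx mul1n big1 ?addn0 // => i /negbTE ->.
exact: mul0n.
Qed.

Lemma size_expand_var l F : F != 0 -> size (expand_var l F) = (max_exp F l).+1.
Proof.
move=> F0; apply/eqP; rewrite eqn_leq; apply/andP; split.
  apply/leq_sizeP => j jd; apply/mpolyP => b; rewrite coef_expand_var mcoeff0.
  case: eqP => [bj|]; rewrite ?mulr0n // memN_msupp_eq0 //.
  by apply/negP => /msupp_le_max_exp/mnm_lepP/(_ l); rewrite bj leqNgt jd.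
have [a aF aE] := max_exp_attained l F0.
rewrite ltnNge; apply/negP => /leq_sizeP/(_ _ (leqnn _))/mpolyP/(_ a)/eqP.
by rewrite coef_expand_var aE eqxx mulr1n mcoeff0 mcoeff_eq0 aF.
Qed.

Lemma expand_varM l A B : expand_var l (A * B) = expand_var l A * expand_var l
  B.
Proof. exact: rmorphM. Qed.

Lemma max_exp_mul A B : A != 0 -> B != 0 -> max_exp (A * B) = (max_exp A +
  max_exp B)%MM.
Proof.
move=> A0 B0; apply/mnmP => l; apply: succn_inj.
have AB0 : A * B != 0 by rewrite mulf_neq0.
have H (p q : {poly {mpoly K[n]}}) x y :
    size p = x.+1 -> size q = y.+1 -> size (p * q) = (x + y).+1.
  by move=> px qy; rewrite size_mul -?size_poly_eq0 ?px ?qy // addSn addnS.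
rewrite mnmDE -(H _ _ _ _ (size_expand_var l A0) (size_expand_var l B0))
  -expand_varM.
exact/esym/size_expand_var.
Qed.

Lemma XfreeP F : Xfree F <-> forall l, (expand_var l F)`_0 != 0.
Proof.
split=> H l; last first.
  have := H l; rewrite -msupp_eq0.
  case E : (msupp _) => [//|a s] _; exists a.
    have : a \in msupp (expand_var l F)`_0 by rewrite E mem_head.
    by rewrite !mcoeff_msupp coef_expand_var; apply: contraNneq => ->;
      rewrite mul0rn.
  have : a \in msupp (expand_var l F)`_0 by rewrite E mem_head.
  rewrite mcoeff_msupp coef_expand_var; have [//|_] := eqVneq (a l) 0%N.
  by rewrite mulr0n eqxx.
have [a aF a0] := H l; apply: contraTneq aF => E.
by have := coef_expand_var l F 0 a;
  rewrite a0 E mcoeff0 mulr1n mcoeff_msupp => <-; rewrite eqxx.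
Qed.

Lemma XfreeM A B : Xfree (A * B) -> Xfree A /\ Xfree B.
Proof.
have H (p q : {poly {mpoly K[n]}}) : (p * q)`_0 != 0 -> p`_0 != 0 /\ q`_0 != 0.
  by rewrite coef0M mulf_eq0 negb_or => /andP[].
move/XfreeP => XAB; suff HAB l : (expand_var l A)`_0 != 0 /\ (expand_var l
  B)`_0 != 0.
  by split; apply/XfreeP => l; have [] := HAB l.
by apply: H; rewrite -expand_varM; exact: XAB.
Qed.

(** After multiplication by (\prod X)^(d + e), [mmap_recip] makes both sides explicit; they agree
    because the degrees in each variable add up. The factor is then cancelled. *)
Lemma recipM A B d e : A != 0 -> B != 0 -> A \is d.-homog -> B \is e.-homog ->
  recip (A * B) = recip A * recip B.
Proof.
move=> A0 B0 hA hB; pose X i : {mpoly K[n]} := 'X_i.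
have X0 : (\prod_k X k) ^+ (d + e) != 0.
  by apply/expf_neq0/prodf_neq0 => i _; rewrite -msupp_eq0 msuppX.
apply: (mulIf X0).
rewrite -[recip (A * B)]mmap_idX (mmap_recip _ _ (dhomogM hA hB)).
rewrite max_exp_mul // commr_mmap1_M; last by move=> i x; apply: mulrC.
rewrite rmorphM /= mulrACA -(mmap_recip _ _ hA) -(mmap_recip _ _ hB).
by rewrite !mmap_idX exprD mulrACA.
Qed.

(** Reciprocation turns a factorization of [recip F] into one of F, since the factors inherit
    [Xfree] from the product. *)
Lemma irr_form_recip F d : F != 0 -> F \is d.-homog -> Xfree F -> irr_form F ->
  irr_form (recip F).
Proof.
move=> F0 hF XF iF a b A B hA hB E.
have /andP[A0 B0] : (A != 0) && (B != 0).
  by rewrite -negb_or -mulf_eq0 -E recip_neq0.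
have [XA XB] : Xfree A /\ Xfree B by apply: XfreeM; rewrite -E;
  exact: Xfree_recip.
have EF : F = recip A * recip B by rewrite -(recipM A0 B0 hA hB) -E recipK.
(* If the reciprocal of G is constant, then [max_exp G], being also that of the reciprocal, is zero,
   and G itself is constant. *)
have H e G : G != 0 -> G \is e.-homog -> Xfree G ->
    (mdeg (max_exp G) - e = 0)%N -> e = 0%N.
  move=> G0 hG XG e0.
  have hR := dhomog_recip hG; rewrite e0 in hR.
  have D0 : max_exp G = 0%MM.
    rewrite -max_exp_recip //; apply/mnmP => l; rewrite mnm0E.
    have [c cR <-] := max_exp_attained l (recip_neq0 G0).
    have /eqP := dhomog_mf hR cR; rewrite /= mdeg_eq0 => /eqP ->.
    exact: mnm0E.
  have := dhomog_mf hG (mlead_supp G0).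
  have /mnm_lepP := msupp_le_max_exp (mlead_supp G0); rewrite D0 => le <- /=.
  apply/eqP; rewrite mdeg_eq0; apply/eqP/mnmP => l; rewrite mnm0E.
  by apply/eqP; rewrite -leqn0 -(mnm0E l) le.
have [e0|e0] := iF _ _ _ _ (dhomog_recip hA) (dhomog_recip hB) EF.
  by left; apply: (H a A).
by right; apply: (H b B).
Qed.

(** A variable dividing F would leave a cofactor of degree d - 1 > 0. The bound on d excludes the
    variables themselves, which are irreducible. *)
Lemma irr_form_Xfree F d : F \is d.-homog -> (1 < d)%N -> irr_form F -> Xfree F.
Proof.
move=> hF d1 iF l; apply: contrapT => N.
have H a : a \in msupp F -> (U_(l) <= a)%MM.
  by move=> aF; rewrite lep1mP; apply/eqP => a0; apply: N; exists a.
pose G := \sum_(a <- msupp F) F@_a *: 'X_[a - U_(l)].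
have hG : G \is d.-1.-homog.
  rewrite /G big_seq; apply: rpred_sum => a aF; rewrite rpredZ // dhomogX /=.
  by rewrite mdeg_subm ?H // mdeg1 -(dhomog_mf hF aF) subn1.
have hX : 'X_l \is [in K[n], 1.-homog] by rewrite dhomogX /= mdeg1.
have E : F = 'X_l * G.
  rewrite {1}[F]mpolyE mulr_sumr; apply: eq_big_seq => a aF.
  by rewrite -scalerAr -mpolyXD addmC submK // H.
by have [//|] := iF _ _ _ _ hX hG E; case: (d) d1 => [|[]].
Qed.

End Cremona.

(** * Linear changes of coordinates and Cremona maps *)

Section LinearSubstitution.

Variables (K : numFieldType) (n : nat).
Implicit Types (F : {mpoly K[n]}) (M N : 'M[K]_n) (p : 'rV[K]_n).

(* The form x |-> F (x *m M). *)
Definition linear_subst M F : {mpoly K[n]} :=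
  mmap (@mpolyC n K) (fun j => \sum_k (M k j) *: 'X_k) F.

Lemma mmap_linear_subst (S : comNzRingType) (f : {rmorphism K -> S}) (h : 'I_n
  -> S) M F :
  mmap f h (linear_subst M F) = mmap f (fun j => \sum_k f (M k j) * h k) F.
Proof.
rewrite /linear_subst mmap_comp; apply: mmap_eqf => j.
by rewrite raddf_sum /=; apply: eq_bigr => k _; rewrite mmapZ mmap_var.
Qed.

Lemma linear_subst_comp M N F : linear_subst N (linear_subst M F) =
  linear_subst (N *m M) F.
Proof.
rewrite {1}/linear_subst mmap_linear_subst; apply: mmap_eqf => j.
under eq_bigr do rewrite mulr_sumr; rewrite exchange_big /=.
apply: eq_bigr => k _; rewrite mxE scaler_suml; apply: eq_bigr => l _.
by rewrite mul_mpolyC scalerA mulrC.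
Qed.

Lemma linear_subst1 F : linear_subst 1%:M F = F.
Proof.
rewrite -[RHS]mmap_idX; apply: mmap_eqf => j.
rewrite (bigD1 j) //= mxE eqxx scale1r big1 ?addr0 // => k kj.
by rewrite mxE (negbTE kj) scale0r.
Qed.

Lemma linear_substK M F : M \in unitmx -> linear_subst (invmx M) (linear_subst
  M F) = F.
Proof. by move=> uM; rewrite linear_subst_comp mulVmx // linear_subst1. Qed.

Lemma linear_subst_neq0 M F : M \in unitmx -> F != 0 -> linear_subst M F != 0.
Proof.
move=> uM; apply: contraNneq => E.
by rewrite -(linear_substK F uM) E /linear_subst mmap0.
Qed.

Lemma dhomog_linear_subst M F d : F \is d.-homog -> linear_subst M F \is
  d.-homog.
Proof.
move=> hF; rewrite /linear_subst /mmap big_seq; apply: rpred_sum => a aF.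
rewrite mul_mpolyC rpredZ //.
have -> : d = (\sum_i a i)%N by rewrite -mdegE -(dhomog_mf hF aF).
rewrite /mmap1; elim/big_rec2: _ => [|i k q _ IH]; first exact: dhomog1.
apply: dhomogM IH; have h1 : \sum_j M j i *: 'X_j \is [in K[n], 1.-homog].
  by apply: rpred_sum => j _; rewrite rpredZ // dhomogX /= mdeg1.
by have := dhomogMn (a i) h1; rewrite mul1n.
Qed.

Lemma irr_form_linear_subst M F : M \in unitmx -> irr_form F -> irr_form
  (linear_subst M F).
Proof.
move=> uM iF d e A B hA hB E.
apply: (iF d e (linear_subst (invmx M) A) (linear_subst (invmx M) B));
  try exact: dhomog_linear_subst.
by rewrite -(linear_substK F uM) E /linear_subst rmorphM.
Qed.

(** Right multiplication by M carries arcs through p to arcs through p M; the inverse matrix gives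
    the converse. *)
Lemma vanish_ge_linear_subst M F p m :
  M \in unitmx -> vanish_ge (linear_subst M F) p m <-> vanish_ge F (p *m M) m.
Proof.
have H N G q : vanish_ge G (q *m N) m -> vanish_ge (linear_subst N G) q m.
  move=> HG g g0; rewrite /arc_eval mmap_linear_subst.
  have := HG (g *m map_mx polyC N); rewrite /arc_eval.
  rewrite (@mmap_eqf _ _ _ _ _ (fun j => \sum_k (N k j)%:P * g 0 k));
    last first.
    by move=> k; rewrite mxE; apply: eq_bigr => l _; rewrite mxE mulrC.
  apply=> k; rewrite !mxE horner_sum; apply: eq_bigr => l _.
  by rewrite mxE hornerM hornerC g0.
move=> uM; split; last exact: H.
by move=> HF; rewrite -(linear_substK F uM); apply: H; rewrite mulmxK.
Qed.

End LinearSubstitution.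

Section CremonaMultiplicity.

Variables (K : numFieldType) (n : nat).
Implicit Types (F : {mpoly K[n]}) (p q : 'rV[K]_n).

(** At the l-th coordinate point the order is the least d - a l over the monomials a, that is, d
    minus the degree in X_l. *)
Lemma mult_delta F d l m : F != 0 -> F \is d.-homog ->
  mult F (delta_mx 0 l) m <-> (max_exp F l + m)%N = d.
Proof.
move=> F0 hF.
have H k : vanish_ge F (delta_mx 0 l) k <-> (max_exp F l + k <= d)%N.
  rewrite (vanish_ge_delta l k hF);
    split=> [H|le a /msupp_le_max_exp /mnm_lepP/(_ l) al].
    by have [a aF <-] := max_exp_attained l F0; apply: H.
  by apply: leq_trans le; rewrite leq_add2r.
rewrite /mult !H addnS; split=> [[le /negP]|->]; last by rewrite ltnn.
by rewrite -leqNgt => ge; apply/eqP; rewrite eqn_leq le.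
Qed.

Definition inv_point p : 'rV[K]_n := \row_l inv_coord (p 0) l.

Lemma inv_point_neq0 p : (forall l, p 0 l != 0) -> forall l, (inv_point p) 0 l
  != 0.
Proof. by move=> p0 l; rewrite mxE; apply/prodf_neq0 => k _. Qed.

Lemma inv_point_scale c p : inv_point (c *: p) = c ^+ n.-1 *: inv_point p.
Proof.
apply/rowP => l; rewrite !mxE -inv_coord_scale; apply: eq_bigr => k _.
by rewrite mxE.
Qed.

Lemma inv_pointK p : (1 < n)%N -> inv_point (inv_point p) = (\prod_k p 0 k) ^+
  n.-2 *: p.
Proof.
move=> n1; apply/rowP => l; rewrite !mxE -inv_coordK //; apply: eq_bigr => k _.
by rewrite mxE.
Qed.

(** Along an arc through q the product of the coordinates is a unit at 0, so [mmap_recip] transfers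
    divisibility by a power of the parameter from F on the inverted arc to [recip F] on the arc. *)
Lemma vanish_ge_recip F d q m : (1 < n)%N -> F != 0 -> F \is d.-homog -> Xfree
  F ->
  (forall l, q 0 l != 0) -> vanish_ge (recip F) q m <-> vanish_ge F (inv_point
    q) m.
Proof.
move=> n1.
have H d' G p : G \is d'.-homog -> (forall l, p 0 l != 0) ->
    vanish_ge G (inv_point p) m -> vanish_ge (recip G) p m.
  move=> hG p0 HG g g0.
  have p0' : (\prod_k g 0 k).[0] != 0.
    by rewrite horner_prod; apply/prodf_neq0 => k _; rewrite g0.
  rewrite -(@dvdXn_unit _ _ ((\prod_k g 0 k) ^+ d')) ?horner_exp ?expf_neq0 //.
  rewrite mulrC /arc_eval (mmap_recip _ _ hG) dvdp_mull //.
  have := HG (\row_l inv_coord (g 0) l); rewrite /arc_eval;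
    under mmap_eqf do rewrite mxE.
  apply=> k; rewrite !mxE /inv_coord horner_prod; apply: eq_bigr => j _;
    exact: g0.
move=> F0 hF XF q0; split; first last.
  exact: H hF q0.
(* The converse is the same implication for [recip F] at [inv_point q], as both reciprocation and,
   up to a nonzero factor, point inversion are involutive. *)
move=> HR; have hR := dhomog_recip hF.
have c0 : (\prod_k q 0 k) ^+ n.-2 != 0.
  by apply/expf_neq0/prodf_neq0 => k _; apply: q0.
rewrite -(recipK XF); apply: (H _ _ _ hR (inv_point_neq0 q0)).
by rewrite inv_pointK // (vanish_ge_scale _ _ hR).
Qed.

End CremonaMultiplicity.

(** * Transport of a form along a Cremona map *)

Section CremonaTransfer.

Variables (K : numFieldType) (n s : nat) (f : 'I_n -> 'I_s).
Implicit Types (P : 'M[K]_(s, n)) (F : {mpoly K[n]}).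

(** Coordinates in the frame of the base points, up to the common factor \det (rowsub f P). The
    adjugate replaces the inverse so that the entries stay polynomial in P. *)
Definition frame_coord P : 'M[K]_(s, n) := P *m \adj (rowsub f P).

(* The images of the points under the Cremona map based at the points indexed
   by f, in coordinates where the base points stay put. *)
Definition cremona_points P : 'M[K]_(s, n) :=
  \matrix_j (if j \in codom f then row j P
             else inv_point (row j (frame_coord P)) *m rowsub f P).

Definition cremona_general P : Prop :=
  \det (rowsub f P) != 0 /\
  forall j, j \notin codom f -> forall l, frame_coord P j l != 0.

Lemma row_rowsub P k : row (f k) P = delta_mx 0 k *m rowsub f P.
Proof. by rewrite -rowE row_rowsub. Qed.

Lemma max_exp_rowsub P F d l m : \det (rowsub f P) != 0 -> F != 0 ->
  F \is d.-homog -> mult F (row (f l) P) m ->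
  (max_exp (linear_subst (rowsub f P) F) l + m)%N = d.
Proof.
move=> dA F0 hF mF; have uA : rowsub f P \in unitmx by rewrite unitmxE unitfE.
apply/(mult_delta l m (linear_subst_neq0 uA F0) (dhomog_linear_subst _ hF)).
by apply: mult_congr mF => k; rewrite vanish_ge_linear_subst // -row_rowsub.
Qed.

(** Let G be F in frame coordinates and delta its vector of degrees in the variables, so that mu (f
    l) = d - delta_l. The reciprocal has degree d' = |delta| - d and the same delta, hence
    multiplicity d' - delta_l at the base points. Summing the mu (f l) gives t = |delta| - 2d, so d'
    = d + t and the base multiplicities also grow by t. Substituting the adjugate returns to the
    original coordinates. *)
Lemma cremona_transfer P F d (mu : 'I_s -> nat) :
  (1 < n)%N -> cremona_general P -> F != 0 -> F \is d.-homog -> (1 < d)%N ->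
  irr_form F -> (forall j, mult F (row j P) (mu j)) ->
  let t : int := (n%:Z - 2) * d%:Z - \sum_k (mu (f k))%:Z in
  exists F' d' mu',
    [/\ F' != 0, F' \is d'.-homog, irr_form F',
        forall j, mult F' (row j (cremona_points P)) (mu' j) &
        d'%:Z = d%:Z + t /\
        forall j, (mu' j)%:Z = if j \in codom f then (mu j)%:Z + t else (mu
          j)%:Z].
Proof.
move=> n1 [dA Q0] F0 hF d1 iF mF t.
set A := rowsub f P in dA Q0 *.
have uA : A \in unitmx by rewrite unitmxE unitfE.
have uB : \adj A \in unitmx.
  rewrite unitmxE unitfE; apply/eqP => dB.
  have := congr1 determinant (mul_mx_adj A);
    rewrite det_mulmx dB mulr0 det_scalar.
  by move/esym/eqP; rewrite expf_eq0 (negbTE dA) andbF.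
pose G := linear_subst A F.
have G0 : G != 0 by apply: linear_subst_neq0.
have hG : G \is d.-homog by apply: dhomog_linear_subst.
have iG : irr_form G by apply: irr_form_linear_subst.
have XG : Xfree G := irr_form_Xfree hG d1 iG.
have dG l : (max_exp G l + mu (f l))%N = d by apply: max_exp_rowsub.
pose d' := (mdeg (max_exp G) - d)%N.
have R0 := recip_neq0 G0; have hR : recip G \is d'.-homog := dhomog_recip hG.
have iR : irr_form (recip G) := irr_form_recip G0 hG XG iG.
(* This bound and [led'] below make the natural number subtractions in [d'] and [mu'] exact. *)
have led : (d <= mdeg (max_exp G))%N.
  have := mlead_supp G0; set a := mlead G => aG.
  rewrite -(dhomog_mf hG aG) /= !mdegE; apply: leq_sum => i _.
  exact/mnm_lepP/msupp_le_max_exp.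
have muE l : (mu (f l))%:Z = d%:Z - (max_exp G l)%:Z.
  by rewrite -(dG l) PoszD addrAC subrr add0r.
have d'E : d'%:Z = d%:Z + t.
  rewrite /d' -subzn // mdegE /t (eq_bigr _ (fun l _ => muE l)) sumrB.
  rewrite sumr_const card_ord -mulr_natl natz.
  rewrite (big_morph Posz PoszD (erefl (0%N : int))).
  ring.
have led' l : (max_exp G l <= d')%N.
  rewrite -max_exp_recip //; have [a aR <-] := max_exp_attained l R0.
  by rewrite -(dhomog_mf hR aR) /= mdegE (bigD1 l) //= leq_addr.
have AB : A *m \adj A = (\det A)%:M := mul_mx_adj A.
pose mu' j := if [pick l | f l == j] is Some l then (d' - max_exp G l)%N else
  mu j.
exists (linear_subst (\adj A) (recip G)), d', mu'; split => //.
- exact: linear_subst_neq0.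
- exact: dhomog_linear_subst.
- exact: irr_form_linear_subst.
- move=> j; rewrite /mu' rowK; case: pickP => [l /eqP <-|N].
    rewrite codom_f row_rowsub.
    apply: (@mult_congr _ _ (recip G) _ (delta_mx 0 l)) => [k|].
      by rewrite vanish_ge_linear_subst // -mulmxA AB mul_mx_scalar
        (vanish_ge_scale _ _ hR).
    by apply/(mult_delta l _ R0 hR); rewrite max_exp_recip // subnKC.
  have jf : j \notin codom f by apply/codomP => -[l E]; have := N l;
    rewrite E eqxx.
  rewrite (negbTE jf); set q := row j (frame_coord P).
  have q0 l : q 0 l != 0 by rewrite mxE Q0.
  apply: mult_congr (mF j) => k.
  rewrite vanish_ge_linear_subst // -mulmxA AB mul_mx_scalar (vanish_ge_scale
    _ _ hR) //.
  rewrite (vanish_ge_recip _ n1 G0 hG XG (inv_point_neq0 q0)) inv_pointK //.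
  rewrite (vanish_ge_scale _ _ hG); last by apply/expf_neq0/prodf_neq0 => i _.
  rewrite vanish_ge_linear_subst // /q /frame_coord row_mul -mulmxA mul_adj_mx
    mul_mx_scalar.
  by rewrite (vanish_ge_scale _ _ hF).
split => // j; rewrite /mu'; case: pickP => [l /eqP <-|N].
  by rewrite codom_f -subzn // d'E muE addrAC.
have /negbTE -> // : j \notin codom f.
by apply/codomP => -[l E]; have := N l; rewrite E eqxx.
Qed.

End CremonaTransfer.

(** * General points *)

Section CremonaInvolution.

Variables (K : numFieldType) (n s : nat) (f : 'I_n -> 'I_s).
Implicit Types (P : 'M[K]_(s, n)).

Lemma rowsub_cremona_points P : rowsub f (cremona_points f P) = rowsub f P.
Proof. by apply/matrixP => k l; rewrite !mxE codom_f mxE. Qed.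

Lemma row_cremona_points_coord P j : j \notin codom f ->
  row j (frame_coord f (cremona_points f P)) = \det (rowsub f P) *: inv_point
    (row j (frame_coord f P)).
Proof.
move=> jf; rewrite /frame_coord row_mul rowsub_cremona_points rowK (negbTE jf)
  -mulmxA.
by rewrite mul_mx_adj mul_mx_scalar.
Qed.

Lemma cremona_general_cremona_points P : cremona_general f P ->
  cremona_general f (cremona_points f P).
Proof.
case=> dA Q0; split=> [|j jf l]; first by rewrite rowsub_cremona_points.
have := congr1 (fun q : 'rV_n => q 0 l) (row_cremona_points_coord P jf).
rewrite mxE => ->; rewrite mxE mulf_neq0 //; apply: inv_point_neq0 => k.
by rewrite mxE Q0.
Qed.

Lemma cremona_points_involutive P : (1 < n)%N -> cremona_general f P ->
  exists c : 'rV[K]_s, (forall j, c 0 j != 0) /\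
    cremona_points f (cremona_points f P) = diag_mx c *m P.
Proof.
move=> n1 [dA Q0]; set D := \det (rowsub f P) in dA *.
(* Off the base points, D^(n-1) comes from the homogeneity of [inv_point] applied to a factor D, the
   power of the product from [inv_pointK], and the last D from the adjugate times the frame
   matrix. *)
exists (\row_j if j \in codom f then 1
  else D ^+ n.-1 * (\prod_k frame_coord f P j k) ^+ n.-2 * D); split=> [j|].
  rewrite mxE; case: ifPn => [_|jf]; first exact: oner_neq0.
  rewrite !mulf_neq0 ?expf_neq0 //.
  by apply/prodf_neq0 => k _; apply: Q0.
apply/row_matrixP => j; have -> c : row j (diag_mx c *m P) = c 0 j *: row j P.
  by apply/rowP => k; rewrite mxE mul_diag_mx !mxE.
rewrite {1}/cremona_points rowK mxE; case: ifPn => jf.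
  by rewrite rowK jf scale1r.
rewrite row_cremona_points_coord // inv_point_scale inv_pointK //
  rowsub_cremona_points -!scalemxAl !scalerA.
rewrite /frame_coord row_mul -mulmxA mul_adj_mx mul_mx_scalar !scalerA.
congr (_ * _ ^+ _ * _ *: _); apply: eq_bigr => k _.
by rewrite -row_mul mxE.
Qed.

End CremonaInvolution.

(** * Polynomial conditions on configurations of points *)

Section Generic.

Variables (R : realType) (r s : nat).
Let C : numFieldType := R[i].
Let n := r.+1.
Implicit Types (P : 'M[C]_(s, n)) (G : {mpoly C[s * n]}).

(** Polynomiality is stated for functions, so that it follows from closure properties and no
    explicit polynomial is needed for determinants, adjugates or [cremona_points]. *)
Definition polyfun (g : 'M[C]_(s, n) -> C) : Prop :=
  exists G, forall P, meval_mx G P = g P.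

Lemma polyfun_ext g h : g =1 h -> polyfun g -> polyfun h.
Proof. by move=> E [G GE]; exists G => P; rewrite GE. Qed.

Lemma polyfun_const c : polyfun (fun=> c).
Proof. by exists c%:MP => P; rewrite /meval_mx mevalC. Qed.

Lemma polyfun_entry i j : polyfun (fun P => P i j).
Proof. by exists 'X_(mxvec_index i j) => P;
  rewrite /meval_mx mevalXU mxvecE. Qed.

Lemma polyfun_add g h : polyfun g -> polyfun h -> polyfun (fun P => g P + h P).
Proof.
by case=> G GE [H HE]; exists (G + H) => P; rewrite -GE -HE /meval_mx mevalD.
Qed.

Lemma polyfun_mul g h : polyfun g -> polyfun h -> polyfun (fun P => g P * h P).
Proof.
by case=> G GE [H HE]; exists (G * H) => P; rewrite -GE -HE /meval_mx mevalM.
Qed.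

Lemma polyfun_sum (I : Type) (e : seq I) (B : pred I) g :
  (forall i, B i -> polyfun (g i)) ->
  polyfun (fun P => \sum_(i <- e | B i) g i P).
Proof.
move=> H; elim: e => [|i e IH].
  by apply: polyfun_ext (polyfun_const 0) => P; rewrite big_nil.
apply: (@polyfun_ext (fun P => (if B i then g i P else 0) +
    \sum_(j <- e | B j) g j P)) => [P|].
  by rewrite big_cons; case: ifP => // _; rewrite add0r.
apply: polyfun_add IH; case E: (B i); [exact: H|exact: polyfun_const].
Qed.

Lemma polyfun_prod (I : Type) (e : seq I) (B : pred I) g :
  (forall i, B i -> polyfun (g i)) ->
  polyfun (fun P => \prod_(i <- e | B i) g i P).
Proof.
move=> H; elim: e => [|i e IH].
  by apply: polyfun_ext (polyfun_const 1) => P; rewrite big_nil.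
apply: (@polyfun_ext (fun P => (if B i then g i P else 1) *
    \prod_(j <- e | B j) g j P)) => [P|].
  by rewrite big_cons; case: ifP => // _; rewrite mul1r.
apply: polyfun_mul IH; case E: (B i); [exact: H|exact: polyfun_const].
Qed.

Lemma polyfun_det m (M : 'M[C]_(s, n) -> 'M[C]_m) :
  (forall i j, polyfun (fun P => M P i j)) -> polyfun (fun P => \det (M P)).
Proof.
move=> H; apply: polyfun_sum => sg _; apply: polyfun_mul.
  exact: polyfun_const.
by apply: polyfun_prod => i _; apply: H.
Qed.

Lemma polyfun_comp g (Phi : 'M[C]_(s, n) -> 'M[C]_(s, n)) :
  polyfun g -> (forall i j, polyfun (fun P => Phi P i j)) ->
  polyfun (fun P => g (Phi P)).
Proof.
move=> [G GE] H.
have /fin_all_exists[E HE] k : exists E : {mpoly C[s * n]},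
    forall P, meval_mx E P = mxvec (Phi P) 0 k.
  by case/mxvec_indexP: k => i j; have [E HE] := H i j; exists E => P;
    rewrite mxvecE.
exists (mmap (@mpolyC _ C) E G) => P; rewrite -GE /meval_mx /meval.
by rewrite (mmap_comp idfun); apply: mmap_eqf => k; rewrite -HE.
Qed.

Lemma polyfun_frame_coord (f : 'I_n -> 'I_s) j l : polyfun (fun P =>
  frame_coord f P j l).
Proof.
apply: (@polyfun_ext (fun P => \sum_k P j k * (\adj (rowsub f P)) k l)) => [P|].
  by rewrite mxE.
apply: polyfun_sum => k _; apply: polyfun_mul; first exact: polyfun_entry.
apply: (@polyfun_ext (fun P => cofactor (rowsub f P) l k)) => [P|].
  by rewrite mxE.
apply: polyfun_mul; first exact: polyfun_const.
apply: polyfun_det => i j';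
  apply: polyfun_ext (polyfun_entry (f (lift l i)) (lift k j')).
by move=> P; rewrite !mxE.
Qed.

Lemma polyfun_cremona_points (f : 'I_n -> 'I_s) j l : polyfun (fun P =>
  cremona_points f P j l).
Proof.
case jf : (j \in codom f).
  by apply: polyfun_ext (polyfun_entry j l) => P; rewrite !mxE jf mxE.
apply: (@polyfun_ext
  (fun P => \sum_k (\prod_(i | i != k) frame_coord f P j i) * P (f k) l)) =>
    [P|].
  rewrite mxE jf mxE; apply: eq_bigr => k _; rewrite !mxE; congr (_ * _).
  by rewrite /inv_coord; apply: eq_bigr => i _; rewrite [RHS]mxE.
apply: polyfun_sum => k _; apply: polyfun_mul; last exact: polyfun_entry.
by apply: polyfun_prod => i _; apply: polyfun_frame_coord.
Qed.

Definition general_poly (f : 'I_n -> 'I_s) P : C :=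
  \det (rowsub f P) * \prod_(j | j \notin codom f) \prod_l frame_coord f P j l.

Lemma general_polyP (f : 'I_n -> 'I_s) P : reflect (cremona_general f P)
  (general_poly f P != 0).
Proof.
rewrite /general_poly mulf_eq0 negb_or; apply: (iffP andP) => -[dA].
  move/prodf_neq0 => H; split => // j jf l.
  by have /prodf_neq0 := H j jf; apply.
by move=> H; split => //; apply/prodf_neq0 => j jf; apply/prodf_neq0 => l _;
  apply: H.
Qed.

Lemma polyfun_gen f : polyfun (general_poly f).
Proof.
apply: polyfun_mul.
  apply: polyfun_det => i j; apply: polyfun_ext (polyfun_entry (f i) j) => P.
  by rewrite mxE.
apply: polyfun_prod => j _; apply: polyfun_prod => l _;
  exact: polyfun_frame_coord.
Qed.

Lemma cremona_general_ex (f : 'I_n -> 'I_s) : injective f ->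
  exists P, cremona_general f P.
Proof.
(* The base points are the coordinate points and all other points are (1 : ... : 1). *)
move=> fI; pose P : 'M[C]_(s, n) :=
  \matrix_(j, l) (if j \in codom f then (j == f l)%:R else 1).
have PA : rowsub f P = 1%:M.
  by apply/matrixP => k l; rewrite !mxE codom_f (inj_eq fI).
exists P; rewrite /cremona_general /frame_coord PA det1; split;
  first exact: oner_neq0.
have adj1 : \adj (1%:M : 'M[C]_n) = 1%:M.
  by have := mul_mx_adj (1%:M : 'M[C]_n); rewrite mul1mx det1.
move=> j jf l; rewrite adj1 mulmx1 mxE (negbTE jf); exact: oner_neq0.
Qed.

Lemma meval_mx_neq0 G : G != 0 -> exists P, meval_mx G P != 0.
Proof.
move=> /mpoly_meval_neq0[v [_ Gv]]; exists (vec_mx (\row_k v k)).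
rewrite /meval_mx (@meval_eq _ _ _ v) // => k.
by rewrite vec_mxK mxE.
Qed.

Lemma meval_mx_neq0E G P : meval_mx G P != 0 -> G != 0.
Proof. by apply: contraNneq => ->; rewrite /meval_mx meval0. Qed.

(** G' is the pullback of G times [general_poly]. To see that it is nonzero, take a general P1 with
    G nonzero at P1 and evaluate at the Cremona image of P1: the image of that image is P1 up to
    rescaling rows, which multihomogeneity of G absorbs. *)
Lemma generic_cremona_points (f : 'I_n -> 'I_s) G :
  (1 < n)%N -> injective f -> G != 0 -> multihomogeneous G ->
  exists2 G', G' != 0 & forall P, meval_mx G' P != 0 ->
    cremona_general f P /\ meval_mx G (cremona_points f P) != 0.
Proof.
move=> n1 fI G0 [e Ge].
have [G' G'E] : polyfun (fun P => general_poly f P * meval_mx G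
  (cremona_points f P)).
  apply: polyfun_mul; first exact: polyfun_gen.
  by apply: polyfun_comp; [exists G|exact: polyfun_cremona_points].
have [H HE] := polyfun_gen f.
have [P0 /general_polyP P0f] := cremona_general_ex fI.
have H0 : H != 0 by apply: (@meval_mx_neq0E _ P0); rewrite HE.
have /meval_mx_neq0[P1] : H * G != 0 by rewrite mulf_neq0.
have -> : meval_mx (H * G) P1 = meval_mx H P1 * meval_mx G P1 by exact: mevalM.
rewrite HE mulf_eq0 negb_or.
case/andP=> /general_polyP P1f GP1.
exists G'; last first.
  by move=> P; rewrite G'E mulf_eq0 negb_or => /andP[/general_polyP].
apply: (@meval_mx_neq0E _ (cremona_points f P1)); rewrite G'E; apply: mulf_neq0.
  exact/general_polyP/cremona_general_cremona_points.
have [c [c0 cE]] := cremona_points_involutive n1 P1f.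
rewrite [X in meval_mx G X](_ : _ = diag_mx c *m P1) // Ge.
by apply: mulf_neq0 GP1; apply/prodf_neq0 => j _; apply: expf_neq0.
Qed.

Definition rowof (k : 'I_(s * n)) : 'I_s :=
  (enum_val (cast_ord (esym (mxvec_cast s n)) k)).1.

Lemma mxvec_diag c P k :
  mxvec (diag_mx c *m P) 0 k = c 0 (rowof k) * mxvec P 0 k.
Proof.
have rowofE i j : rowof (mxvec_index i j) = i.
  by rewrite /rowof /mxvec_index cast_ordK enum_rankK.
by case/mxvec_indexP: k => i j; rewrite !mxvecE rowofE mul_diag_mx mxE.
Qed.

Definition wrow (j : 'I_s) (k : 'I_(s * n)) : nat := rowof k == j.

(** Scaling row j by c makes G a polynomial in c with the given value as one of its coefficients. It
    is therefore nonzero; multiplying it by the variable yields a c that is itself nonzero. *)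
Lemma weight_part_row_scale G j e P : meval_mx (weight_part (wrow j) e G) P !=
  0 ->
  exists c : 'rV[C]_s, (forall i, c 0 i != 0) /\ meval_mx G (diag_mx c *m P)
    != 0.
Proof.
rewrite /meval_mx /meval -(@coef_mmap_weight _ C C idfun).
set q := mmap _ _ _ => qe.
have [c] : exists c, (q * 'X).[c] != 0.
  apply: contrapT => N; have /poly_horner_eq0/eqP : forall c, (q * 'X).[c] = 0.
    by move=> c; apply/eqP; apply: contrapT => /negP cN; apply: N; exists c.
  rewrite mulf_eq0 polyX_eq0 orbF => /eqP q0.
  by rewrite q0 coef0 eqxx in qe.
rewrite hornerM hornerX mulf_eq0 negb_or => /andP[qc c0].
exists (\row_i (c ^+ (i == j))); split=> [i|]; first by rewrite mxE expf_neq0.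
move: qc; rewrite /q -horner_evalE rmorph_mmap.
rewrite (_ : mmap _ _ _ = mmap idfun (fun k => mxvec (diag_mx (\row_i (c ^+ (i
  == j))) *m P) 0 k) G) //.
rewrite /mmap; apply: eq_bigr => a _; congr (_ * _).
  by rewrite /= horner_evalE hornerC.
apply: mmap1_eq => k /=; rewrite horner_evalE hornerZ hornerXn.
by rewrite mxvec_diag mxE mulrC.
Qed.

(** A condition stable under rescaling of rows that holds off a hypersurface of matrices thus holds
    off a hypersurface of (P^r)^s. *)
Lemma multihomogeneous_component G : G != 0 ->
  exists G', [/\ G' != 0, multihomogeneous G' &
    forall P, meval_mx G' P != 0 -> exists c : 'rV[C]_s,
      (forall i, c 0 i != 0) /\ meval_mx G (diag_mx c *m P) != 0].
Proof.
(* The multidegree is that of the leading monomial, so the component extracted, row by row, is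
   nonzero. *)
move=> G0; pose a0 := mlead G.
pose e j := weight (wrow j) a0.
pose fold t := foldr (fun j H => weight_part (wrow j) (e j) H) G t.
have fE t b : (fold t)@_b = G@_b *+ all (fun j => weight (wrow j) b == e j) t.
  elim: t => [|j t IH] //=; rewrite mcoeff_weight_part IH.
  by case: (_ == _); rewrite ?mulr1n // mulr0n.
have fS t P : meval_mx (fold t) P != 0 -> exists c : 'rV[C]_s,
    (forall i, c 0 i != 0) /\ meval_mx G (diag_mx c *m P) != 0.
  elim: t P => [|j t IH] P /=.
    move=> GP; exists (const_mx 1); split=> [i|];
      first by rewrite mxE oner_neq0.
    by rewrite (_ : diag_mx _ = 1%:M) ?mul1mx // diag_const_mx.
  case/weight_part_row_scale => c [c0 /IH[c' [c'0]]];
    rewrite mulmxA mulmx_diag => H.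
  exists (\row_k (c' 0 k * c 0 k)); split=> // i.
  by rewrite mxE mulf_neq0.
exists (fold (enum 'I_s)); split; last exact: fS.
  rewrite -msupp_eq0; apply: contraTneq (mlead_supp G0) => E.
  have : a0 \notin msupp (fold (enum 'I_s)) by rewrite E.
  rewrite !mcoeff_msupp fE (_ : all _ _) //; by apply/allP.
exists e => c P; rewrite /meval_mx !mevalE mulr_sumr; apply: eq_big_seq => a aF.
rewrite mulrCA; congr (_ * _).
under eq_bigr do rewrite mxvec_diag exprMn.
rewrite big_split /=; congr (_ * _).
have ae j : e j = weight (wrow j) a.
  move: aF; rewrite mcoeff_msupp fE; case: allP => [H _|_];
    last by rewrite eqxx.
  by apply/esym/eqP/H; rewrite mem_enum.
under [RHS]eq_bigr do rewrite ae /weight -prodrXr.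
rewrite exchange_big /=; apply: eq_bigr => k _.
rewrite (bigD1 (rowof k)) //= {1}/wrow eqxx mul1n big1 ?mulr1 // => j.
by rewrite /wrow eq_sym => /negbTE ->; rewrite mul0n expr0.
Qed.

End Generic.

(** * The Weyl group and Noether's inequality *)

Lemma enum_set (T : finType) (I : {set T}) k : #|I| = k ->
  exists2 f : 'I_k -> T, injective f & forall j, (j \in codom f) = (j \in I).
Proof.
move=> <-; exists enum_val => [|j]; first exact: enum_val_inj.
apply/codomP/idP => [[l ->]|jI]; first exact: enum_valP.
by exists (enum_rank_in jI j); rewrite enum_rankK_in.
Qed.

Lemma sum_codom (T : finType) (I : {set T}) k (f : 'I_k -> T) (g : T -> int) :
  injective f -> (forall j, (j \in codom f) = (j \in I)) ->
  \sum_(j in I) g j = \sum_l g (f l).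
Proof.
move=> fI fE; transitivity (\sum_(l in [set: 'I_k]) g (f l)); last first.
  by apply: eq_bigl => l; rewrite inE.
rewrite -(big_imset g (in2W fI)); apply: eq_bigl => j; rewrite -fE.
by apply/codomP/imsetP => [[l ->]|[l _ ->]]; exists l.
Qed.

Section Numerical.

Variables (r s : nat).
Implicit Types (i : int) (x : A1 s) (I : {set 'I_s}).

(** The pairing with -K is r - 1 times (r + 1) d - \sum m_j; as r > 1 the factor cancels, leaving
    integral equations. *)
Lemma numerical_classP i x : (1 < r)%N ->
  numerical_class r i x <->
  (r%:Z - 1) * x.1 ^+ 2 - \sum_j x.2 0 j ^+ 2 = i /\
  (r%:Z + 1) * x.1 - \sum_j x.2 0 j = 2 + i.
Proof.
move=> r1; rewrite /numerical_class.
have -> : dm_pairing r x x = (r%:Z - 1) * x.1 ^+ 2 - \sum_j x.2 0 j ^+ 2.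
  by rewrite /dm_pairing expr2 mulrA.
have -> : dm_pairing r x (- class_K r s) =
    (r%:Z - 1) * ((r%:Z + 1) * x.1 - \sum_j x.2 0 j).
  rewrite /dm_pairing /= opprK mulrBr mulr_sumr; congr (_ - _).
    by rewrite -mulrA [x.1 * _]mulrC.
  by apply: eq_bigr => j _; rewrite !mxE opprK mulrC.
rewrite rmorphM /= mulKf; last by rewrite intr_eq0 subr_eq0; lia.
by split=> -[-> H]; split=> //; [apply: intr_inj H | rewrite H].
Qed.

Lemma cremona_numerical i I x : (1 < r)%N -> #|I| = r.+1 ->
  numerical_class r i x -> numerical_class r i (cremona r I x).
Proof.
move=> r1 cI; rewrite !numerical_classP //=.
set S := \sum_(j in I) _; set t := (r%:Z - 1) * x.1 - S.
have SE : S = \sum_j (if j \in I then x.2 0 j else 0) by rewrite /S big_mkcond.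
have sI : \sum_j (if j \in I then t else 0) = (r%:Z + 1) * t.
  by rewrite -big_mkcond sumr_const cI -mulr_natl natz -addn1 PoszD.
have -> : \sum_j (\row_k (if k \in I then x.2 0 k + t else x.2 0 k)) 0 j =
    \sum_j x.2 0 j + (r%:Z + 1) * t.
  rewrite -sI -big_split /=; apply: eq_bigr => j _.
  by rewrite mxE; case: ifP; rewrite ?addr0.
have -> : \sum_j (\row_k (if k \in I then x.2 0 k + t else x.2 0 k)) 0 j ^+ 2 =
    \sum_j x.2 0 j ^+ 2 + (2 * t * S + (r%:Z + 1) * t * t).
  rewrite -sI SE mulr_suml mulr_sumr -!big_split /=.
  apply: eq_bigr => j _; rewrite mxE; case: ifP => _; ring.
move=> [<- E]; split; last by rewrite -E; ring.
have -> : S = (r%:Z - 1) * x.1 - t by rewrite /t; ring.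
ring.
Qed.

Lemma cremona_orbit i I x : #|I| = r.+1 ->
  weyl_orbit_hyperplane r i (cremona r I x) -> weyl_orbit_hyperplane r i x.
Proof.
move=> cI [w ww E]; exists (cremona r I \o w); first exact: weyl_cremona.
by rewrite /= -E cremonaK.
Qed.

Lemma perm_eq_bool (u v : seq bool) :
  size u = size v -> count id u = count id v -> perm_eq u v.
Proof.
move=> suv cuv; apply/seq.permP => a.
have H w : count a w = (a true * count id w + a false * (size w - count id
  w))%N.
  rewrite -(count_predC id w) addKn.
  by elim: w => [|[] w IH]; rewrite /= ?IH ?muln0 //; lia.
by rewrite !H suv cuv.
Qed.

(** For d = 1 both \sum m_j^2 and \sum m_j equal r - 1 - i, so \sum m_j (m_j - 1) = 0. Its terms are
    nonnegative on nonnegative integers, so exactly r - 1 - i of the m_j are 1 and the others 0; a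
    permutation moves the ones to the front. *)
Lemma degree1_orbit i x : i \in [:: -1; 0; 1] -> (1 < r)%N -> (r < s)%N ->
  (forall j, 0 <= x.2 0 j) -> numerical_class r i x -> x.1 = 1 ->
  weyl_orbit_hyperplane r i x.
Proof.
move=> hi r1 rs x0 /(numerical_classP _ _ r1)[E1 E2] x1.
rewrite x1 expr1n !mulr1 in E1 E2.
have m01 j : x.2 0 j = 0 \/ x.2 0 j = 1.
  have : \sum_j x.2 0 j * (x.2 0 j - 1) = 0.
    under eq_bigr do rewrite mulrBr mulr1 -expr2.
    rewrite sumrB; move: E1 E2.
    set a := \sum_j _ ^+ 2; set b := \sum_j x.2 0 j; clearbody a b; lia.
  move/eqP; rewrite psumr_eq0 => [/allP/(_ j)|k _].
    rewrite mem_index_enum => /(_ isT); rewrite /= mulf_eq0 subr_eq0.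
    by case/orP=> /eqP; [left|right].
  have := x0 k; rewrite le_eqVlt => /orP[/eqP <-|k0]; first by rewrite mul0r.
  by apply: mulr_ge0; lia.
have [k kE] : exists k : nat, k%:Z = r%:Z - 1 - i.
  by exists (absz (r%:Z - 1 - i)%R); move: hi; rewrite !inE => /or3P[]/eqP ->;
    lia.
have ks : (k <= s)%N by move: hi; rewrite !inE => /or3P[]/eqP ?; lia.
pose u := [tuple x.2 0 j == 1 | j < s]; pose v := [tuple (val j < k)%N | j < s].
have cE (B : 'I_s -> bool) : count id [tuple B j | j < s] = (\sum_j B j)%N.
  rewrite -sum1_count big_map big_enum_cond big_mkcond /=.
  by apply: eq_bigr => j _; case: (B j).
have /tuple_permP[sg sgE] : perm_eq u v.
  apply: perm_eq_bool; first by rewrite !size_tuple.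
  rewrite !cE; have -> : (\sum_(j < s) (j < k) = k)%N.
    transitivity (\sum_(j < k) 1)%N;
      last by rewrite sum_nat_const card_ord muln1.
    rewrite (big_ord_widen _ (fun=> 1%N) ks) [RHS]big_mkcond /=.
    by apply: eq_bigr => j _; case: (_ < _)%N.
  suff : (\sum_j (x.2 0 j == 1)%R)%N%:Z = k%:Z by case.
  rewrite kE (big_morph Posz PoszD (erefl (0%N : int))).
  rewrite (eq_bigr (fun j => x.2 0 j)) => [|j _].
    by move: E2; set b := \sum_j x.2 0 j; clearbody b; lia.
  by case: (m01 j) => ->.
exists (permute sg \o id); first by apply: weyl_permute; exact: weyl_id.
rewrite [LHS]surjective_pairing x1; congr pair; apply/rowP => j; rewrite !mxE.
have : tnth u j = tnth v (sg j).
  by rewrite (tnth_nth true) sgE -(tnth_nth true) tnth_mktuple.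
rewrite !tnth_mktuple -kE => H; rewrite (_ : (_ < _) = (sg j < k)%N) // -H.
by case: (m01 j) => ->.
Qed.

(** Degree 0 is impossible, as it would give -\sum m_j = 2 + i > 0. *)
Lemma degree_le1_orbit i x : i \in [:: -1; 0; 1] -> (1 < r)%N -> (r < s)%N ->
  0 <= x.1 <= 1 -> (forall j, 0 <= x.2 0 j) -> numerical_class r i x ->
  weyl_orbit_hyperplane r i x.
Proof.
move=> hi r1 rs /andP[x1 x1'] x0 nx.
apply: degree1_orbit => //; apply/eqP; apply: contraT => N.
have x10 : x.1 = 0 by lia.
case/(numerical_classP _ _ r1): nx => _; rewrite x10 mulr0 sub0r.
have : 0 <= \sum_j x.2 0 j by apply: sumr_ge0.
by move: hi; rewrite !inE => /or3P[]/eqP ->; lia.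
Qed.

Lemma top_subset (T : finType) (m : T -> int) k : (k <= #|T|)%N ->
  exists2 I : {set T}, #|I| = k &
    forall j l, j \notin I -> l \in I -> m j <= m l.
Proof.
elim: k => [|k IH] kT.
  by exists set0 => [|j l _]; rewrite ?cards0 // inE.
have [I cI HI] := IH (ltnW kT).
have /set0Pn[j0] : ~: I != set0 by rewrite -card_gt0 cardsCs setCK cI subn_gt0.
rewrite inE => j0I.
case: (@arg_maxP _ _ _ j0 (fun j => j \notin I) m j0I) => j1 j1I max1.
exists (j1 |: I); first by rewrite cardsU1 j1I cI.
move=> j l; rewrite !inE negb_or => /andP[_ jI] /orP[/eqP ->|lI].
  exact: max1.
exact: HI.
Qed.

(** Let mu be the least m_j on I. Then m_j (m_j - mu) is at most d (m_j - mu) on I and at most 0 off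
    I. Summing and inserting the two numerical equations bounds mu. *)
Lemma noether i x I : i \in [:: -1; 0; 1] -> (1 < r)%N -> #|I| = r.+1 ->
  numerical_class r i x ->
  (forall j l, j \notin I -> l \in I -> x.2 0 j <= x.2 0 l) ->
  (forall j, 0 <= x.2 0 j) -> (forall j, j \in I -> x.2 0 j <= x.1) ->
  \sum_(j in I) x.2 0 j <= (r%:Z - 1) * x.1 -> x.1 <= 1.
Proof.
move=> hi r1 cI /(numerical_classP _ _ r1)[E1 E2] top m0 md St.
set m := fun j => x.2 0 j in E1 E2 top m0 md St.
have [l0 l0I] : exists l0, l0 \in I by apply/set0Pn; rewrite -card_gt0 cI.
case: (@arg_minP _ _ _ l0 (mem I) m l0I) => l1 l1I min1.
set mu := m l1 in min1.
have cmu : \sum_(j in I) mu = (r%:Z + 1) * mu.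
  by rewrite sumr_const cI -mulr_natl natz -addn1 PoszD.
have L : \sum_j m j * (m j - mu) <= \sum_(j in I) x.1 * (m j - mu).
  rewrite [leRHS]big_mkcond; apply: ler_sum => j _; case: ifPn => jI.
    by apply: ler_wpM2r; rewrite ?md // subr_ge0 min1.
  by apply: mulr_ge0_le0; rewrite ?m0 // subr_le0 top.
have LE : \sum_j m j * (m j - mu) = (r%:Z - 1) * x.1 ^+ 2 - i
    - mu * ((r%:Z + 1) * x.1 - (2 + i)).
  under eq_bigr do rewrite mulrBr -expr2.
  by rewrite sumrB -mulr_suml -E2 -E1; ring.
rewrite -mulr_sumr sumrB cmu LE in L.
have x10 : 0 <= x.1 by apply: le_trans (md l1 l1I).
(* The terms in d^2 and in mu d cancel. As i <= 1 and mu is a nonnegative integer, this forces mu =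
   0. *)
have L2 : (2 + i) * mu <= i.
  have := lerD L (ler_wpM2l x10 St); rewrite -subr_ge0 => H.
  by rewrite -subr_ge0; apply: (le_trans H); rewrite le_eqVlt; apply/orP;
    left; apply/eqP; ring.
have mu0 : 0 <= mu := m0 l1.
have muE : mu = 0 by move: hi L2; rewrite !inE => /or3P[]/eqP ->; lia.
have SI : \sum_j m j = \sum_(j in I) m j.
  rewrite [RHS]big_mkcond; apply: eq_bigr => j _; case: ifPn => // jI.
  by apply/eqP; rewrite eq_le m0 andbT -muE top.
(* All multiplicities off I are now 0, so the hypothesis bounds the full sum (r + 1) d - (2 + i) by
   (r - 1) d. *)
have H : 2 * x.1 <= 2 + i.
  move: St; rewrite -SI -E2 -subr_ge0 -[in X in _ -> X]subr_ge0 => H.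
  by apply: (le_trans H); rewrite le_eqVlt; apply/orP; left; apply/eqP; ring.
by move: hi H; rewrite !inE => /or3P[]/eqP ->; lia.
Qed.

(** For I containing j the Cremona action has t = 1 on E_j and gives degree 1 with multiplicity 1 on
    I minus j: a hyperplane through r points, settled by [degree1_orbit]. *)
Lemma exceptional_orbit i (j : 'I_s) :
  i \in [:: -1; 0; 1] -> (1 < r)%N -> (r < s)%N ->
  numerical_class r i (class_E j) -> weyl_orbit_hyperplane r i (class_E j).
Proof.
move=> hi r1 rs nE.
(* Ordering the indices by the indicator of j makes the top r + 1 of them contain j. *)
have [I cI HI] : exists2 I : {set 'I_s}, #|I| = r.+1 &
    forall j' l, j' \notin I -> l \in I -> ((j' == j)%:R : int) <= (l == j)%:R.
  by apply: top_subset; rewrite card_ord.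
have [l lI] : exists l, l \in I by apply/set0Pn; rewrite -card_gt0 cI.
have jI : j \in I.
  have cI1 : (1 < #|I|)%N by rewrite cI ltnS ltnW.
  apply: contraLR cI1 => jI; rewrite -leqNgt.
  apply: leq_trans (_ : #|[set j]| <= 1)%N; last by rewrite cards1.
  apply: subset_leq_card; apply/subsetP => k kI; rewrite inE.
  by have := HI _ _ jI kI; rewrite eqxx; case: (k == j).
have tE : (r%:Z - 1) * 0 - \sum_(k in I) (- delta_mx 0 j : 'rV[int]_s) 0 k = 1.
  rewrite mulr0 sub0r (bigD1 j) //= !mxE !eqxx big1 ?addr0 ?opprK // => k
    /andP[_].
  by rewrite !mxE eqxx => /negbTE ->; rewrite oppr0.
apply: (cremona_orbit cI); apply: degree1_orbit => //.
- move=> k; rewrite /cremona /= tE !mxE eqxx /=.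
  by case: (eqVneq k j) => [->|_]; rewrite ?jI //; case: ifP.
- exact: cremona_numerical.
- by rewrite /cremona /= tE.
Qed.

End Numerical.

(** * Descent *)

Section Descent.

Variables (R : realType) (r s : nat).
Let C : numFieldType := R[i].
Implicit Types (P : 'M[C]_(s, r.+1)) (x : A1 s) (i : int).

(** All that the descent retains of a non-exceptional prime divisor: an irreducible equation with
    its degree and multiplicities. *)
Definition realized P x : Prop := exists (F : {mpoly C[r.+1]}) d (mu : 'I_s ->
  nat),
  [/\ F != 0, F \is d.-homog, irr_form F, forall j, mult F (row j P) (mu j) &
      x = (d%:Z, \row_j (mu j)%:Z)].

(** One hypersurface suffices for each class; countably many are needed only to treat all classes at
    once. *)
Definition generic (U : 'M[C]_(s, r.+1) -> Prop) : Prop :=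
  exists G : {mpoly C[s * r.+1]},
    [/\ G != 0, multihomogeneous G & forall P, meval_mx G P != 0 -> U P].

Lemma multihomogeneous1 : multihomogeneous (1 : {mpoly C[s * r.+1]}).
Proof. by exists (fun=> 0%N) => c P; rewrite /meval_mx !meval1 mulr1 big1. Qed.

Lemma generic_all (U : 'M[C]_(s, r.+1) -> Prop) : (forall P, U P) -> generic U.
Proof.
move=> H; exists 1; split => //; [exact: oner_neq0|exact: multihomogeneous1].
Qed.

Lemma generic_scale (U : 'M[C]_(s, r.+1) -> Prop) (G : {mpoly C[s * r.+1]}) :
  (forall (c : 'rV[C]_s) P, (forall j, c 0 j != 0) -> U (diag_mx c *m P) -> U
    P) ->
  G != 0 -> (forall P, meval_mx G P != 0 -> U P) -> generic U.
Proof.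
move=> US /multihomogeneous_component[G' [G'0 mG' H]] GU.
by exists G'; split => // P /H[c [c0 /GU]]; apply: US.
Qed.

Lemma realized_scale (c : 'rV[C]_s) P x : (forall j, c 0 j != 0) ->
  realized P x -> realized (diag_mx c *m P) x.
Proof.
move=> c0 [F [d [mu [F0 hF iF mF ->]]]]; exists F, d, mu; split => // j.
apply: mult_congr (mF j) => k.
have -> : row j (diag_mx c *m P) = c 0 j *: row j P.
  by apply/rowP => l; rewrite mxE mul_diag_mx !mxE.
by rewrite (vanish_ge_scale _ _ hF).
Qed.

Lemma realized_ge0 P x : realized P x -> 0 <= x.1 /\ forall j, 0 <= x.2 0 j.
Proof. by case=> F [d [mu [_ _ _ _ ->]]]; split=> //= j; rewrite mxE. Qed.

Lemma realized_cremona (f : 'I_r.+1 -> 'I_s) (I : {set 'I_s}) P x :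
  injective f -> (forall j, (j \in codom f) = (j \in I)) -> (0 < r)%N ->
  cremona_general f P -> 1 < x.1 -> realized P x ->
  realized (cremona_points f P) (cremona r I x).
Proof.
move=> fI fE r0 Pf x1 [F [d [mu [F0 hF iF mF xE]]]].
have d1 : (1 < d)%N by move: x1; rewrite xE.
have [F' [d' [mu' [F'0 hF' iF' mF' [d'E mu'E]]]]] :=
  cremona_transfer (r0 : (1 < r.+1)%N) Pf F0 hF d1 iF mF.
exists F', d', mu'; split => //.
have tE : (r%:Z - 1) * x.1 - \sum_(j in I) x.2 0 j =
    (r.+1%:Z - 2) * d%:Z - \sum_k (mu (f k))%:Z.
  rewrite (sum_codom _ fI fE) xE /=; have -> : r.+1%:Z - 2 = r%:Z - 1 by lia.
  congr (_ - _); by apply: eq_bigr => l _; rewrite mxE.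
rewrite /cremona tE; congr pair; first by rewrite d'E xE.
apply/rowP => j; rewrite !mxE mu'E fE xE /= mxE.
by case: (j \in I).
Qed.

Lemma generic_not_realized k i x : i \in [:: -1; 0;
  1] -> (1 < r)%N -> (r < s)%N ->
  numerical_class r i x -> ~ weyl_orbit_hyperplane r i x -> x.1 < k%:Z ->
  generic (fun P => ~ realized P x).
Proof.
move=> hi r1 rs; elim: k x => [|k IH] x nx ox xk.
  by apply: generic_all => P /realized_ge0[]; rewrite leNgt xk.
have [neg|x0] := pselect (~ forall j, 0 <= x.2 0 j).
  by apply: generic_all => P /realized_ge0[].
have {}x0 := contrapT x0.
have [x1|x1] := lerP x.1 1.
  apply: generic_all => P /realized_ge0[d0 _]; apply: ox.
  by apply: degree_le1_orbit => //; rewrite d0.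
have [I cI HI] : exists2 I : {set 'I_s}, #|I| = r.+1 &
    forall j l, j \notin I -> l \in I -> x.2 0 j <= x.2 0 l.
  by apply: top_subset; rewrite card_ord.
have [f fI fE] := enum_set cI.
have US (c : 'rV[C]_s) P : (forall j, c 0 j != 0) ->
    ~ realized (diag_mx c *m P) x -> ~ realized P x.
  by move=> c0 N /(realized_scale c0).
(* In the first case it is enough that the base points be independent: the multiplicities there are
   then at most the degree, as Noether's inequality requires. *)
have [tge|tlt] := lerP (\sum_(j in I) x.2 0 j) ((r%:Z - 1) * x.1).
  have [H HE] := @polyfun_gen R r s f.
  have [P0 /general_polyP P0f] := @cremona_general_ex R r s f fI.
  apply: (generic_scale US (@meval_mx_neq0E R r s H P0 _)); first by rewrite HE.
  move=> P; rewrite HE => /general_polyP[dA _] rP.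
  suff : x.1 <= 1 by rewrite leNgt x1.
  apply: (noether hi r1 cI nx HI x0) => // j.
  rewrite -fE => /codomP[l ->].
  case: rP => F [d [mu [F0 hF iF mF ->]]]; rewrite mxE /=.
  by rewrite -(max_exp_rowsub dA F0 hF (mF (f l))) lez_nat leq_addl.
(* Now t < 0, so the Cremona image has smaller degree; it is still numerical and outside the
   orbit. *)
have [|||G [G0 mG HG]] := IH (cremona r I x).
- exact: cremona_numerical.
- by move=> /(cremona_orbit cI).
- move: xk tlt; rewrite /cremona /=;
  move: (\sum_(j in I) _) ((_ - 1) * _) => S T.
  by lia.
have [G' G'0 HG'] := generic_cremona_points (ltnW r1 : (1 < r.+1)%N) fI G0 mG.
apply: (generic_scale US G'0) => P /HG'[Pf /HG N] rP; apply: N.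
by apply: realized_cremona => //; apply: ltnW.
Qed.

End Descent.

(** * From prime divisors to irreducible forms *)

Section Geometry.

Variables (R : realType) (r s : nat).
Let C : numFieldType := R[i].
Implicit Types (P : 'M[C]_(s, r.+1)) (D : bl_coord R r s -> Prop).

Definition zero_locus P (A : {mpoly C[r.+1]}) (z : bl_coord R r s) : Prop :=
  blowup P z /\ A.@[fun k => z.1 0 k] = 0.

Lemma zero_locus_closed P A d :
  A \is d.-homog -> zariski_closed P (zero_locus P A).
Proof.
move=> hA; split=> [z []//|z z' bz' [/andP[_ /sub_rVP[c cE]] _] [_ Az]|].
  split=> //; rewrite /meval (@mmap_eqf _ _ _ _ _ (fun k => c * z.1 0 k)).
    by rewrite (mmap_dhomog_scale idfun _ _ hA) [mmap _ _ _]Az mulr0.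
  by move=> k; rewrite cE mxE.
(* [B] is A in the coordinates of the first row of the stacked matrix, which is [z.1]. *)
pose B : {mpoly C[(1 + s) * r.+1]} :=
  mmap (@mpolyC _ C) (fun k => 'X_(mxvec_index (lshift s (0 : 'I_1)) k)) A.
exists (fun G => G = B) => z bz.
have BE : meval_mx B (col_mx z.1 z.2) = A.@[fun k => z.1 0 k].
  rewrite /meval_mx /meval /B (mmap_comp idfun); apply: mmap_eqf => k.
  by rewrite mmap_var mxvecE col_mxEu.
split=> [[_ Az] G ->|H]; first by rewrite BE.
by split=> //; rewrite -BE; apply: H.
Qed.

(** If F = A B, then D lies in the union of the zero loci of A and B, hence in one of them, say that
    of A. As F generates the ideal of the image of D, it divides A, so B is a unit and has degree
    0. *)
Lemma prime_divisor_hirr P D F : prime_divisor P D -> image_equation D F ->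
  F != 0 -> irr_form F.
Proof.
move=> [[[Dbl _ _] _ irr] _ _] eqF F0 d e A B hA hB FE.
have H d' e' A' B' : A' \is d'.-homog -> B' \is e'.-homog -> F = A' * B' ->
    zsub D (zero_locus P A') -> e' = 0%N.
  move=> hA' hB' E DA; have [Q QE] : exists Q, A' = Q * F.
    by apply/eqF => z /DA[].
  have /andP[A'0 B'0] : (A' != 0) && (B' != 0) by rewrite -negb_or -mulf_eq0 -E.
  have QB : Q * B' = 1.
    by apply: (mulfI A'0); rewrite mulr1 {2}QE E mulrCA.
  have B'c : 0%MM \in msupp B'.
    have := congr1 (meval (fun=> 0)) QB; rewrite mevalM meval1 => QB0.
    rewrite mcoeff_msupp -meval_coef0; apply: contra_eq_neq QB0 => ->.
    by rewrite mulr0 eq_sym oner_neq0.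
  by have := dhomog_mf hB' B'c; rewrite /= mdeg0.
have DF z : D z -> zero_locus P A z \/ zero_locus P B z.
  move=> Dz; have : F.@[fun k => z.1 0 k] = 0.
    by apply: (iffRL (eqF F)) Dz; exists 1; rewrite mul1r.
  rewrite FE mevalM => /eqP; rewrite mulf_eq0 => /orP[]/eqP E; [left|right];
    by split=> //; apply: Dbl.
have [DA|DB] := irr _ _ (zero_locus_closed P hA) (zero_locus_closed P hB) DF.
  by right; apply: H hA hB FE DA.
by left; apply: H hB hA _ DB; rewrite mulrC.
Qed.

Lemma has_multiplicity_mult (F : {mpoly C[r.+1]}) p m :
  has_multiplicity F p m -> mult F p m.
Proof.
case=> H [a am ap]; split; first exact/vanish_ge_mderivm.
by move/vanish_ge_mderivm => /(_ a); rewrite am ltnSn => /(_ isT) /eqP;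
  rewrite (negbTE ap).
Qed.

Lemma has_multiplicity_neq0 (F : {mpoly C[r.+1]}) p m :
  has_multiplicity F p m -> F != 0.
Proof.
case=> _ [a _]; apply: contraNneq => ->.
by rewrite (raddf0 (mderivm a)) meval0.
Qed.

End Geometry.

Theorem corollary3p21 (R : realType) (i : int) (r s : nat)
    (hi : i \in [:: -1; 0; 1]) (hr : (2 <= r)%N) (hs : (r.+1 <= s)%N) :
  @for_very_general_points R r s (fun P =>
    forall (D : bl_coord R r s -> Prop) (x : A1 s),
      prime_divisor P D -> divisor_class P D x -> numerical_class r i x ->
      weyl_hyperplane P i D).
Proof.
(* One polynomial is chosen for each class; 1 serves for classes that are not numerical or already
   lie in the orbit. *)
have /choice[g gP] x : exists G : {mpoly R[i][s * r.+1]},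
    [/\ G != 0, multihomogeneous G & forall P, meval_mx G P != 0 ->
      numerical_class r i x -> realized P x -> weyl_orbit_hyperplane r i x].
  have [nx|nx] := pselect (numerical_class r i x); last first.
    by apply: generic_all => P /nx.
  have [ox|ox] := pselect (weyl_orbit_hyperplane r i x).
    exact: generic_all.
  have [|G [G0 mG GP]] := @generic_not_realized R r s (absz x.1).+1 i x hi hr
    hs nx ox.
    by lia.
  by exists G; split => // P /GP N _ /N.
(* The lattice is countable: the polynomials are indexed by codes of classes, with 1 at numbers that
   code no class. *)
exists (fun k => if unpickle k is Some x then g x else 1);
  split=> [k|P _ GP D x pD].
  case: (unpickle k) => [x|]; first by have [] := gP x.
  by split; [exact: oner_neq0|exact: multihomogeneous1].
move=> dx nx; split => //; exists x => //;
  case: dx nx => [j _|d m F hF eF mF] nx.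
  exact: exceptional_orbit.
(* A multiplicity at the first point, which exists as s > 0, supplies a nonvanishing derivative of
   F. *)
have F0 : F != 0.
  by apply: (has_multiplicity_neq0 (mF (Ordinal (leq_trans (ltn0Sn r) hs)))).
set y : A1 s := (d%:Z, \row_j (m j)%:Z) in nx *.
have [_ _ /(_ P)] := gP y; apply; [|exact: nx|].
  by have := GP (pickle y); rewrite pickleK.
exists F, d, m; split => //; first exact: prime_divisor_hirr pD eF F0.
by move=> j; apply: has_multiplicity_mult.
Qed.
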